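(* Let $\Omega\subset\mathbb{R}^d$ be a smooth bounded domain, let $\kappa\equiv\kappa_0\eta$ with a constant $\kappa_0>0$, and let $p=m\in\mathbb{N}$, $p\ge1$. Then there exists a constant $C(\kappa_0,p)$ such that all smooth solutions $(v,w)$, $w\ge0$, of $$\dot v=\operatorname{div}(\eta(w)\nabla v),\qquad \dot w=\operatorname{div}(\kappa(w)\nabla w)+\eta(w)|\nabla v|^2\quad\text{in }]0,T]\times\Omega,$$ with boundary conditions $\eta(w)\nabla v\cdot\mathrm n=0=\kappa(w)\nabla w\cdot\mathrm n$ on $]0,T]\times\partial\Omega$ and initial data $v(0,\cdot)=v^0$, $w(0,\cdot)=w^0$ satisfy $$\|v(t)\|_{L^{2p}(\Omega)}^2+\|w(t)\|_{L^p(\Omega)}\le C(\kappa_0,p)\big(\|v^0\|_{L^{2p}(\Omega)}^2+\|w^0\|_{L^p(\Omega)}\big)\quad\text{for all }t\in[0,T].$$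
   Context: $\eta:[0,\infty[\to[0,\infty[$ is the given viscosity function (with prototype $\eta(w)=\eta_0w^\alpha$, $\eta_0,\alpha>0$). Smooth solutions means classical solutions, regular up to the boundary and up to $t=0$; $\mathrm n$ is the outer unit normal. *)

(* Defs.v *)
From HB Require Import structures.
From mathcomp Require Import all_boot all_order all_algebra.
From mathcomp Require Import all_classical all_reals all_analysis.

Set Implicit Arguments.
Unset Strict Implicit.
Unset Printing Implicit Defensive.

Import Order.TTheory GRing.Theory Num.Theory.
Import numFieldNormedType.Exports.

Local Open Scope classical_set_scope.
Local Open Scope ring_scope.

Section LebesgueRd.
Context {R : realType}.

Definition tuple_cons (n : nat)
    (z : measurableTypeR R * n.-tuple (measurableTypeR R)) :
    n.+1.-tuple (measurableTypeR R) :=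
  [the n.+1.-tuple (measurableTypeR R) of z.1 :: z.2].

Lemma measurable_tuple_cons (n : nat) :
  measurable_fun [set: measurableTypeR R * n.-tuple (measurableTypeR R)]
    (@tuple_cons n).
Proof. exact: measurable_cons. Qed.

HB.instance Definition _ (n : nat) :=
  isMeasurableFun.Build _ _ _ _ (@tuple_cons n) (@measurable_tuple_cons n).

Section step.
Variables (n : nat)
  (mu : {measure set (n.-tuple (measurableTypeR R)) -> \bar R}).

(* The product measure dx (x) mu on R x R^n, carried over to R^(n+1). *)
Definition lebesgue_cons : set (n.+1.-tuple (measurableTypeR R)) -> \bar R :=
  pushforward (lebesgue_measure \x^ mu)%E (@tuple_cons n).

Let lebesgue_cons0 : lebesgue_cons set0 = 0%E.
Proof. exact: measure0. Qed.

Let lebesgue_cons_ge0 A : (0 <= lebesgue_cons A)%E.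
Proof. exact: measure_ge0. Qed.

Let lebesgue_cons_sigma_additive : semi_sigma_additive lebesgue_cons.
Proof. exact: measure_semi_sigma_additive. Qed.

HB.instance Definition _ := isMeasure.Build _ _ _ lebesgue_cons
  lebesgue_cons0 lebesgue_cons_ge0 lebesgue_cons_sigma_additive.

End step.

Fixpoint lebesgue_tuple (d : nat) :
    {measure set (d.-tuple (measurableTypeR R)) -> \bar R} :=
  match d with
  | 0 => dirac ([tuple] : 0.-tuple (measurableTypeR R))
  | n.+1 => lebesgue_cons (lebesgue_tuple n)
  end.

(* Measurable sets live on d.-tuple R, the topology and the derivatives on
   'rV[R]_d; a function on 'rV[R]_d is integrated through the identification
   of a tuple with the row vector of its entries. *)
Definition row_of_tuple (d : nat) (z : d.-tuple (measurableTypeR R)) :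
    'rV[R]_d :=
  \row_(i < d) (tnth z i : R).

Definition Lp_norm (d : nat) (Omega : set 'rV[R]_d) (q : nat)
    (f : 'rV[R]_d -> R) : \bar R :=
  Lnorm (lebesgue_tuple d) (q%:R)%:E
    (fun z => ((f \_ Omega) (row_of_tuple z))%:E).

End LebesgueRd.

Section VectorCalculus.
Context {R : realType} {d : nat}.
Implicit Types (f : 'rV[R]_d -> R) (F : 'rV[R]_d -> 'rV[R]_d) (x : 'rV[R]_d).

Definition basis_vec (i : 'I_d) : 'rV[R]_d := delta_mx 0 i.

(* The norm `|x| of 'rV[R]_d is the sup norm, so Euclidean lengths are
   expressed by this inner product. *)
Definition dotp (a b : 'rV[R]_d) : R := \sum_(i < d) a 0 i * b 0 i.

Definition partial (i : 'I_d) f x : R := 'D_(basis_vec i) f x.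

Definition grad f x : 'rV[R]_d := \row_(i < d) partial i f x.

Definition div F x : R := \sum_(i < d) partial i (fun y => F y 0 i) x.

(* f is k times continuously differentiable on the open set U. *)
Fixpoint Ck_on (k : nat) (U : set 'rV[R]_d) f : Prop :=
  (forall x, U x -> {for x, continuous f}) /\
  match k with
  | 0 => True
  | k'.+1 => forall i : 'I_d,
      (forall x, U x -> derivable f x (basis_vec i)) /\
      Ck_on k' U (partial i f)
  end.

Definition Coo_on (U : set 'rV[R]_d) f : Prop := forall k, Ck_on k U f.

End VectorCalculus.

Section SmoothDomains.
Context {R : realType} {d : nat}.
Implicit Types (Omega U : set 'rV[R]_d) (rho : 'rV[R]_d -> R).

Definition boundary Omega : set 'rV[R]_d := closure Omega `\` interior Omega.

(* On the neighbourhood U of x0 the set Omega is {rho < 0}, where rho is smooth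
   with non-vanishing gradient; so the boundary of Omega in U is the smooth
   hypersurface {rho = 0}, and Omega lies on one side of it. *)
Definition defining_function Omega (x0 : 'rV[R]_d) U rho : Prop :=
  [/\ open U, U x0, Coo_on U rho,
      forall x, U x -> grad rho x != 0 &
      forall x, U x -> (Omega x <-> rho x < 0)].

Record smooth_bounded_domain Omega : Prop := {
  domain_open : open Omega;
  domain_connected : connected Omega;
  domain_nonempty : Omega !=set0;
  domain_bounded : bounded_set Omega;
  domain_smooth_boundary : forall x0, boundary Omega x0 ->
    exists U rho, defining_function Omega x0 U rho }.

Definition outer_unit_normal Omega (x0 n : 'rV[R]_d) : Prop :=
  exists U rho, defining_function Omega x0 U rho /\
    n = (Num.sqrt (dotp (grad rho x0) (grad rho x0)))^-1 *: grad rho x0.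

End SmoothDomains.

Section ClassicalSolutions.
Context {R : realType} {d : nat}.
Variables (Omega : set 'rV[R]_d) (T : R).

Definition closed_cylinder : set (R * 'rV[R]_d) := `[0, T] `*` closure Omega.

Definition continuous_up_to_boundary (V : topologicalType)
    (f : R -> 'rV[R]_d -> V) : Prop :=
  {within closed_cylinder, continuous (fun z => f z.1 z.2)}.

(* Derivative at t relative to [0, T]; it is one-sided at t = 0 and t = T. *)
Definition is_time_derivative (g : R -> R) (t l : R) : Prop :=
  (s - t)^-1 * (g s - g t) @[s --> within `[0, T] t^'] --> l.

(* u is of class C^1 in t and C^2 in x, up to the boundary and up to t = 0, T:
   ut, Du and D2u are the time derivative, the spatial gradient and the spatial
   Hessian of u over Omega, together with their continuous extensions to the
   closure of Omega. *)
Record C12_up_to_boundary (u ut : R -> 'rV[R]_d -> R)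
    (Du : R -> 'rV[R]_d -> 'rV[R]_d) (D2u : R -> 'rV[R]_d -> 'M[R]_d) :
    Prop := {
  C12_cont : continuous_up_to_boundary u;
  C12_cont_dt : continuous_up_to_boundary ut;
  C12_cont_grad : continuous_up_to_boundary Du;
  C12_cont_hess : continuous_up_to_boundary D2u;
  C12_dt : forall t x, 0 <= t <= T -> Omega x ->
    is_time_derivative (u ^~ x) t (ut t x);
  C12_grad : forall t x i, 0 <= t <= T -> Omega x ->
    is_derive x (basis_vec i) (u t) (Du t x 0 i);
  C12_hess : forall t x i j, 0 <= t <= T -> Omega x ->
    is_derive x (basis_vec j) (fun y => Du t y 0 i) (D2u t x i j) }.

(* The regularity that gives the divergence and the normal component of a flux
   a pointwise meaning.  For a continuously differentiable viscosity it follows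
   from the regularity of v and w; the viscosity may be less regular, e.g.
   eta s = s^a with a < 1 near s = 0. *)
Definition classical_flux (F : 'rV[R]_d -> 'rV[R]_d) : Prop :=
  {within closure Omega, continuous F} /\
  forall i, Ck_on 1 Omega (fun x => F x 0 i).

(* Classical solution (v, w) of
     v' = div (eta(w) grad v),
     w' = div (kappa(w) grad w) + eta(w) |grad v|^2   in ]0, T] x Omega,
   with no-flux conditions on ]0, T] x boundary Omega. *)
Definition smooth_solution (eta kappa : R -> R) (v w : R -> 'rV[R]_d -> R) :
    Prop :=
  exists vt Dv D2v wt Dw D2w,
  let flux_v t x := eta (w t x) *: Dv t x in
  let flux_w t x := kappa (w t x) *: Dw t x in
  [/\ C12_up_to_boundary v vt Dv D2v,
      C12_up_to_boundary w wt Dw D2w,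
      forall t, 0 < t <= T ->
        classical_flux (flux_v t) /\ classical_flux (flux_w t),
      forall t x, 0 < t <= T -> Omega x ->
        vt t x = div (flux_v t) x /\
        wt t x = div (flux_w t) x + eta (w t x) * dotp (Dv t x) (Dv t x) &
      forall t x n, 0 < t <= T -> boundary Omega x ->
        outer_unit_normal Omega x n ->
        dotp (flux_v t x) n = 0 /\ dotp (flux_w t x) n = 0].

End ClassicalSolutions.

(* Main.v *)
Require Import Defs.
From HB Require Import structures.
From mathcomp Require Import all_boot all_order all_algebra.
From mathcomp Require Import all_classical all_reals all_analysis.
From mathcomp Require Import measurable_realfun.
From mathcomp Require Import ring lra zify.

Set Implicit Arguments.
Unset Strict Implicit.
Unset Printing Implicit Defensive.

Import Order.TTheory GRing.Theory Num.Theory.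
Import numFieldNormedType.Exports.

Local Open Scope classical_set_scope.
Local Open Scope ring_scope.

(** The estimate comes from the Lyapunov functional int E(v, w) with
    E(v, w) = sum_k c_k v^(2k) w^(p-k), 0 <= k <= p.  For a solution,

      d/dt int E(v, w) = int div G - int eta(w) Q,
      G = E_v eta grad v + E_w kappa grad w,
      Q = (E_vv - E_w) |grad v|^2 + (1 + kappa0) E_vw (grad v . grad w)
          + kappa0 E_ww |grad w|^2,

    and Q >= 0 for w >= 0 as soon as the c_k grow like lambda^(k^2) with a large
    lambda: each mixed term of Q is absorbed by the two neighbouring terms of the
    squares ([energy_quadratic]).  Hence int E does not increase
    ([energy_nonincreasing]).  Since all c_k are at least 1, E(v, w) is
    comparable to v^(2p) + w^p ([energy_ge], [energy_le]), and the estimate follows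
    by taking p-th roots ([powR_le_sum]); the constant only involves kappa0 and p.

    It remains that int div G = 0 ([integral_div_eq0]).  The field G is tangential
    at the boundary, but for a nonsmooth eta the derivatives of its components need
    not stay bounded there; the boundary is therefore approached by cut-offs.
    After localization by a partition of unity, Omega is {rho < 0} near a boundary
    point, with one partial derivative of rho bounded away from zero.
    A cut-off chi that climbs from 0 to 1 in the layer eps < - rho < 2 eps makes the
    field compactly supported, and then each derivative integrates to zero along
    the coordinate lines ([integral_div_cut0]).  The error is the integral of
    G . grad chi, a multiple of the normal flux G . grad rho, which tends to zero
    uniformly in the layer ([normal_flux_small]); the total mass of |grad chi| stays
    bounded, because on each line in the distinguished direction chi is monotone
    with values in [0, 1] ([integral_cube_partial_le]). *)

(** * Boxes and Fubini's theorem on tuples *)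

Section Boxes.
Context {R : realType}.
Notation leb := (@lebesgue_measure R).

Definition box (d : nat) (b : R) : set (d.-tuple (measurableTypeR R)) :=
  [set z | forall i, tnth z i \in `[- b, b]].

Lemma measurable_coordwise d (A : 'I_d -> set (measurableTypeR R)) :
  (forall i, measurable (A i)) ->
  measurable [set z : d.-tuple (measurableTypeR R) | forall i, A i (tnth z i)].
Proof.
move=> mA; rewrite (_ : [set _ | _] =
    \bigcap_(i in [set: 'I_d]) ((fun z => tnth z i) @^-1` A i)).
  apply: fin_bigcap_measurable => // i _; rewrite -[X in measurable X]setTI.
  by apply: measurable_tnth => //; exact: mA.
by apply/seteqP; split => [z Az i _|z Az i]; [exact: Az|exact: (Az i I)].
Qed.

Lemma measurable_box d (b : R) : measurable (@box d b).
Proof.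
apply: (@measurable_coordwise d (fun=> `[- b, b]%classic)) => _.
exact: measurable_itv.
Qed.

Lemma box_cons d (b s : R) (y : d.-tuple (measurableTypeR R)) :
  box b (tuple_cons (s, y)) <-> (s \in `[- b, b]) /\ box b y.
Proof.
split=> [bz|[bs by_] i].
  split=> [|i]; first by have := bz ord0; rewrite tnth0.
  by have := bz (lift ord0 i); rewrite tnthS.
by case: (unliftP ord0 i) => [j ->|->]; rewrite ?tnth0// tnthS.
Qed.

Lemma lebesgue_sym_itv (b : R) : 0 <= b -> leb `[- b, b]%classic = (b *+ 2)%:E.
Proof.
move=> b0; rewrite lebesgue_measure_itv/= lte_fin.
case: ltP => [_|bb]; first by rewrite -EFinB opprK -mulr2n.
by have -> : b = 0 by [lra]; rewrite mul0rn.
Qed.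

Lemma lebesgue_box d (b : R) : 0 <= b ->
  lebesgue_tuple d (@box d b) = ((b *+ 2) ^+ d)%:E :> \bar R.
Proof.
move=> b0; elim: d => [|d IH].
  rewrite /= diracE mem_set// => i; by case: i.
rewrite /= /lebesgue_cons /pushforward.
have -> : @tuple_cons R d @^-1` @box d.+1 b = `[- b, b]%classic `*` @box d b.
  by apply/seteqP; split => -[s y] /=; rewrite box_cons.
rewrite product_measure2E//; last exact: measurable_box.
by rewrite [X in (_ * X)%E]IH [X in (X * _)%E]lebesgue_sym_itv// exprS EFinM.
Qed.

Lemma sigma_finite_lebesgue_tuple d :
  sigma_finite setT (lebesgue_tuple d : set _ -> \bar R).
Proof.
exists (fun n => box n%:R).
  apply/seteqP; split => // z _.
  exists (Num.truncn (\sum_(i < d) `|tnth z i : R|)).+1 => // i.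
  have : `|tnth z i : R| <= \sum_(i < d) `|tnth z i : R|.
    by rewrite (bigD1 i)//= lerDl sumr_ge0.
  move=> /le_lt_trans /(_ (truncnS_gt _)) /ltW.
  by rewrite ler_norml in_itv.
move=> n; split; first exact: measurable_box.
by rewrite lebesgue_box// ltry.
Qed.

(** Fubini's theorem asks for a sigma-finite instance, which is attached to this
    alias of the recursively defined measure. *)
Definition lebesgue_sigma d : set (d.-tuple (measurableTypeR R)) -> \bar R :=
  lebesgue_tuple d.

HB.instance Definition _ d := Measure.copy (@lebesgue_sigma d) (lebesgue_tuple d).

HB.instance Definition _ d := Measure_isSigmaFinite.Build _ _ _
  (@lebesgue_sigma d) (sigma_finite_lebesgue_tuple d).

(** A bounded measurable function with bounded support: a class that is stable
    under slicing, and in which every iterated integral makes sense. *)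
Definition box_bounded d (b M : R) (g : d.-tuple (measurableTypeR R) -> R) :=
  [/\ measurable_fun setT g, forall z, `|g z| <= M &
      forall z, ~ box b z -> g z = 0].

Lemma integrable_bounded_support (dT : measure_display) (T : measurableType dT)
    (mu : {measure set T -> \bar R}) (A : set T) (M : R) (f : T -> R) :
  measurable A -> (mu A < +oo)%E -> measurable_fun setT f ->
  (forall x, `|f x| <= M) -> (forall x, ~ A x -> f x = 0) ->
  mu.-integrable setT (EFin \o f).
Proof.
move=> mA Afin mf fM f0.
have -> : EFin \o f = (EFin \o f) \_ A.
  apply/funext => z; rewrite patchE; case: ifPn => // /negP bz.
  by rewrite /= f0// => ?; apply: bz; rewrite inE.
apply: (integrable_mkcond _ mA).1; apply: measurable_bounded_integrable => //.
- exact: measurable_funTS.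
- by exists M; split => [|y My z _ /=]; rewrite ?num_real// (le_trans (fM _))// ltW.
Qed.

Lemma integrable_box_bounded d (b M : R) (g : d.-tuple (measurableTypeR R) -> R) :
  0 <= b -> box_bounded b M g -> (lebesgue_tuple d).-integrable setT (EFin \o g).
Proof.
move=> b0 [mg gM g0].
refine (@integrable_bounded_support _ _ (lebesgue_tuple d) _ _ _ (@measurable_box d b) _ mg gM g0).
by rewrite lebesgue_box// ltry.
Qed.

Lemma measurable_consl d (s : measurableTypeR R) :
  measurable_fun setT (fun y : d.-tuple (measurableTypeR R) => tuple_cons (s, y)).
Proof. apply: measurable_cons; [exact: measurable_cst|exact: measurable_id]. Qed.

Lemma measurable_consr d (y : d.-tuple (measurableTypeR R)) :
  measurable_fun setT (fun s : measurableTypeR R => tuple_cons (s, y)).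
Proof. apply: measurable_cons; [exact: measurable_id|exact: measurable_cst]. Qed.

Lemma box_bounded_slicel d (b M : R) (g : d.+1.-tuple (measurableTypeR R) -> R) s :
  box_bounded b M g -> box_bounded b M (fun y => g (tuple_cons (s, y))).
Proof.
move=> [mg gM g0]; split => // [|z nbz]; last by apply: g0; rewrite box_cons; case.
exact: measurableT_comp mg (measurable_consl _).
Qed.

Lemma integrable_slicer d (b M : R) (g : d.+1.-tuple (measurableTypeR R) -> R) y :
  0 <= b -> box_bounded b M g ->
  leb.-integrable setT (EFin \o (fun s => g (tuple_cons (s, y)))).
Proof.
move=> b0 [mg gM g0]; apply: (@integrable_bounded_support _ (measurableTypeR R) leb `[- b, b]%classic M) => //.
- by rewrite [X in (X < _)%E]lebesgue_sym_itv// ltry.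
- exact: measurableT_comp mg (measurable_consr _).
- by move=> s sb; apply: g0; rewrite box_cons; case.
Qed.

(** Fubini for the splitting of R^(d+1) into a line and R^d, in both orders; the
    order decides which coordinate is integrated first. *)
Lemma Rintegral_cons d (b M : R) (g : d.+1.-tuple (measurableTypeR R) -> R) :
  0 <= b -> box_bounded b M g ->
  [/\ measurable_fun setT (fun y => \int[leb]_s g (tuple_cons (s, y))),
      measurable_fun setT
        (fun s => \int[lebesgue_tuple d]_y g (tuple_cons (s, y))),
      \int[lebesgue_tuple d.+1]_z g z =
        \int[lebesgue_tuple d]_y \int[leb]_s g (tuple_cons (s, y)) &
      \int[lebesgue_tuple d.+1]_z g z =
        \int[leb]_s \int[lebesgue_tuple d]_y g (tuple_cons (s, y))].
Proof.
move=> b0 bg; have ig := integrable_box_bounded b0 bg.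
have [mg gM g0] := bg.
have mc := @measurable_tuple_cons R d.
pose h := g \o @tuple_cons R d.
have mh : measurable_fun setT h by apply: measurableT_comp.
pose A := `[- b, b]%classic `*` @box d b.
have mA : measurable A by apply: measurableX => //; exact: measurable_box.
have h0 z : ~ A z -> h z = 0.
  by case: z => s y nA; apply: g0; rewrite box_cons.
have Afin : (leb `[(- b)%R, b]%classic * @lebesgue_sigma d (box b) < +oo)%E.
  by rewrite /= [X in (_ * X)%E]lebesgue_box// lebesgue_sym_itv// -EFinM ltry.
have hM z : `|h z| <= M by exact: gM.
have ih2 : (leb \x^ @lebesgue_sigma d)%E.-integrable setT (EFin \o h).
  apply: (@integrable_bounded_support _ _ (leb \x^ @lebesgue_sigma d)%E A M _ mA _ mh hM h0).
  by rewrite [X in (X < _)%E]product_measure2E//; exact: measurable_box.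
have ih1 : (leb \x @lebesgue_sigma d)%E.-integrable setT (EFin \o h).
  apply: (@integrable_bounded_support _ _ (leb \x @lebesgue_sigma d)%E A M _ mA _ mh hM h0).
  by rewrite [X in (X < _)%E]product_measure1E//; exact: measurable_box.
have E : (\int[lebesgue_tuple d.+1]_x (g x)%:E =
          \int[(leb \x^ @lebesgue_sigma d)]_x (h x)%:E)%E.
  have mg' : measurable_fun setT (EFin \o g) by exact/measurable_EFinP.
  exact: (@integral_pushforward _ _ _ _ R _ mc (leb \x^ @lebesgue_sigma d)%E setT (EFin \o g) mg' ih2 measurableT).
have GE : fubini_G leb (EFin \o h) =
    EFin \o (fun y => \int[leb]_s g (tuple_cons (s, y))).
  apply/funext => y; rewrite /fubini_G /Rintegral /= fineK//.
  exact/integrable_fin_num/(integrable_slicer _ b0 bg).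
have FE : fubini_F (@lebesgue_sigma d) (EFin \o h) =
    EFin \o (fun s => \int[lebesgue_tuple d]_y g (tuple_cons (s, y))).
  apply/funext => s; rewrite /fubini_F /Rintegral /= fineK//.
  exact/integrable_fin_num/(integrable_box_bounded b0)/box_bounded_slicel/bg.
split.
- by apply/measurable_EFinP; rewrite -GE; exact: measurable_fubini_G ih1.
- by apply/measurable_EFinP; rewrite -FE; exact: measurable_fubini_F ih1.
- by rewrite {1}/Rintegral E -(integral21_prod_meas2 ih1) GE.
- by rewrite {1}/Rintegral E -(integral12_prod_meas2 ih1) FE.
Qed.

End Boxes.

(** * Integrals controlled by line integrals *)

Section Slices.
Context {R : realType}.
Notation leb := (@lebesgue_measure R).

Definition set_coord d (i : 'I_d) (s : R) (z : d.-tuple (measurableTypeR R)) :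
    d.-tuple (measurableTypeR R) :=
  [tuple if k == i then s : measurableTypeR R else tnth z k | k < d].

Lemma set_coord0 d s u (y : d.-tuple (measurableTypeR R)) :
  set_coord ord0 s (tuple_cons (u, y)) = tuple_cons (s, y).
Proof.
apply: eq_from_tnth => k; rewrite tnth_mktuple.
case: (unliftP ord0 k) => [j ->|->]; last by rewrite eqxx tnth0.
by rewrite !tnthS.
Qed.

Lemma set_coordS d (j : 'I_d) s u (y : d.-tuple (measurableTypeR R)) :
  set_coord (lift ord0 j) s (tuple_cons (u, y)) =
  tuple_cons (u, set_coord j s y).
Proof.
apply: eq_from_tnth => k; rewrite tnth_mktuple.
case: (unliftP ord0 k) => [l ->|->]; last by rewrite !tnth0.
by rewrite !tnthS tnth_mktuple (inj_eq lift_inj).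
Qed.

Lemma le_Rintegral_support (dT : measure_display) (T : measurableType dT)
    (mu : {measure set T -> \bar R}) (A : set T) (m delta : R) (f : T -> R) :
  measurable A -> mu A = m%:E -> measurable_fun setT f ->
  (forall x, `|f x| <= delta) -> (forall x, ~ A x -> f x = 0) ->
  `|\int[mu]_x f x| <= delta * m.
Proof.
move=> mA muA mf fd f0.
have fA : f = f \_ A.
  apply/funext => z; rewrite patchE; case: ifPn => // /negP bz.
  by rewrite /= f0// => ?; apply: bz; rewrite inE.
have iA : mu.-integrable A (EFin \o f).
  apply: integrableS (integrable_bounded_support mA _ mf fd f0) => //.
  by rewrite muA ltry.
rewrite fA -Rintegral_mkcond.
apply: (le_trans (le_normr_Rintegral mA iA)).
have -> : delta * m = \int[mu]_(x in A) delta.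
  by rewrite Rintegral_cst// muA.
apply: le_Rintegral => //.
- exact: integrable_abse iA.
- apply/integrableP; split; first exact: measurable_cst.
  rewrite integral_cst//= muA -EFinM ltry//.
Qed.

(** An integral is controlled by the line integrals in any fixed coordinate
    direction: integrating the bound over the d - 1 other coordinates costs one
    side length of the box each.  With the bound 0 this yields the vanishing of
    the integral of a derivative; with a bound uniform in a small parameter it
    controls a thin boundary layer. *)
Lemma Rintegral_slice_le d (i : 'I_d) (b M delta : R)
    (g : d.-tuple (measurableTypeR R) -> R) :
  0 <= b -> box_bounded b M g ->
  (forall z, `|\int[leb]_s g (set_coord i s z)| <= delta) ->
  `|\int[lebesgue_tuple d]_z g z| <= delta * (b *+ 2) ^+ d.-1.
Proof.
move=> b0; elim: d i g => [[]//|d IH] i g bg gd; have [mg gM g0] := bg.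
case: (unliftP ord0 i) => [j|] iE; last first.
  have [mG _ -> _] := Rintegral_cons b0 bg.
  apply: (le_Rintegral_support (@measurable_box R d b) (lebesgue_box d b0)).
  - exact: mG.
  - move=> y; have := gd (tuple_cons (0, y)).
    by rewrite iE; under eq_Rintegral do rewrite set_coord0.
  - move=> y nby; apply/eqP; rewrite [X in X == _](_ : _ = \int[leb]_s cst 0 s).
      by rewrite Rintegral_cst// mul0r.
    by apply: eq_Rintegral => s _; apply: g0; rewrite box_cons; case.
have [_ mF _ ->] := Rintegral_cons b0 bg.
have d0 : (0 < d)%N by apply: leq_ltn_trans (ltn_ord j).
have -> : (b *+ 2) ^+ d.+1.-1 = (b *+ 2) ^+ d.-1 * (b *+ 2).
  by rewrite -exprSr prednK.
rewrite mulrA.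
apply: (@le_Rintegral_support _ (measurableTypeR R) leb `[- b, b]%classic) => //.
- exact: lebesgue_sym_itv.
- move=> s; apply: (IH j (fun y => g (tuple_cons (s, y)))); first exact: box_bounded_slicel bg.
  move=> y; have := gd (tuple_cons (s, y)).
  by rewrite iE; under eq_Rintegral do rewrite set_coordS.
- move=> s nbs; apply/eqP; rewrite [X in X == _](_ : _ = \int[lebesgue_tuple d]_y cst 0 y).
    by rewrite Rintegral_cst// mul0r.
  by apply: eq_Rintegral => y _; apply: g0; rewrite box_cons; case.
Qed.

End Slices.

(** * Measurability of continuous functions *)

Section Measurability.
Context {R : realType} {d : nat}.
Implicit Types (x : 'rV[R]_d) (U : set 'rV[R]_d).

Lemma ball_rVP x (e : R) y :
  0 < e -> (ball x e y <-> forall i, `|x 0 i - y 0 i| < e).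
Proof.
move=> e0; split=> [[_ xy] i|xy]; first exact: xy.
by split => // i j; rewrite !ord1; exact: xy.
Qed.

Lemma measurable_ball_tuple x (e : R) :
  measurable (@row_of_tuple R d @^-1` ball x e).
Proof.
have [e0|e0] := ltP 0 e; last first.
  rewrite (_ : _ @^-1` _ = set0)//; apply/seteqP; split => // z /= [e1].
  by rewrite ltNge e0 in e1.
have -> : @row_of_tuple R d @^-1` ball x e =
    [set z | forall i, `]x 0 i - e, x 0 i + e[%classic (tnth z i)].
  apply/seteqP; split => [z /(ball_rVP _ _ e0) xz i|z xz].
    by have := xz i; rewrite mxE /= in_itv/= ltr_distlC.
  apply/(ball_rVP _ _ e0) => i; have := xz i.
  by rewrite mxE /= in_itv/= ltr_distlC.
apply: (@measurable_coordwise R d (fun i => `]x 0 i - e, x 0 i + e[%classic)).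
by move=> i; exact: measurable_itv.
Qed.

(** The product sigma-algebra contains the open sets, since these are countable
    unions of balls with rational centers and radii 1/(n+1). *)
Lemma measurable_open_tuple U : open U -> measurable (@row_of_tuple R d @^-1` U).
Proof.
move=> oU.
pose c (q : d.-tuple rat) : 'rV[R]_d := \row_i ratr (tnth q i).
pose F k := if (unpickle k : option (d.-tuple rat * nat)) is Some (q, n) then
  if `[< ball (c q) n.+1%:R^-1 `<=` U >] then ball (c q) n.+1%:R^-1 else set0
  else set0.
have -> : U = \bigcup_k F k.
  apply/seteqP; split => [x Ux|x [k _]]; last first.
    rewrite /F; case: unpickle => // -[q n]; case: asboolP => // bU.
    exact: bU.
  have /nbhs_ballP[e /= e0 eU] := open_nbhs_nbhs (conj oU Ux).
  have e20 : 0 < e / 2 by rewrite divr_gt0.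
  have [n ne] : exists n, n.+1%:R^-1 < e / 2.
    exists (Num.truncn (e / 2)^-1).
    by rewrite invf_plt ?posrE// truncnS_gt.
  have n0 : 0 < n.+1%:R^-1 :> R by rewrite invr_gt0.
  have /choice[q qE] : forall i : 'I_d, exists q : rat,
      `|ratr q - x 0 i| < n.+1%:R^-1.
    move=> i; have [|q] := @rat_in_itvoo R (x 0 i - n.+1%:R^-1) (x 0 i + n.+1%:R^-1).
      by rewrite ltrBlDr -addrA ltrDl addr_gt0.
    by rewrite in_itv/= => qx; exists q; rewrite distrC ltr_distlC.
  exists (pickle ([tuple q i | i < d], n)) => //; rewrite /F pickleK.
  case: asboolP => [_|]; first by apply/(ball_rVP _ _ n0) => i; rewrite mxE tnth_mktuple.
  case=> y /(ball_rVP _ _ n0) cy; apply: eU; apply/(ball_rVP _ _ e0) => i.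
  rewrite (le_lt_trans (ler_distD (ratr (q i)) _ _))// [ltRHS](splitr e) ltrD//.
    by rewrite distrC (lt_trans (qE i)).
  by have := cy i; rewrite mxE tnth_mktuple => /lt_trans; apply.
rewrite preimage_bigcup; apply: bigcup_measurable => k _; rewrite /F.
case: unpickle => [[q n]|]; last by rewrite preimage_set0.
by case: asboolP => _; rewrite ?preimage_set0//; exact: measurable_ball_tuple.
Qed.

Lemma measurable_fun_open U (f : 'rV[R]_d -> R) :
  open U -> (forall x, U x -> {for x, continuous f}) ->
  measurable_fun (@row_of_tuple R d @^-1` U) (f \o @row_of_tuple R d).
Proof.
move=> oU cf; apply: (measurability _ (RGenOpens.measurableE R)).
move=> _ [_ [a [b ->] <-]].
apply: (@measurable_open_tuple (U `&` f @^-1` `]a, b[%classic)).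
rewrite openE => x [Ux fx].
apply: filterI; first exact: open_nbhs_nbhs.
by apply: cf => //; apply: open_nbhs_nbhs; split => //; exact: interval_open.
Qed.

End Measurability.

(** * The fundamental theorem of calculus along coordinate lines *)

Section LineIntegrals.
Context {R : realType} {d : nat}.
Notation leb := (@lebesgue_measure R).
Implicit Types (x y : 'rV[R]_d) (i : 'I_d).

Lemma row_set_coord i s (z : d.-tuple (measurableTypeR R)) :
  row_of_tuple (set_coord i s z) =
  row_of_tuple (set_coord i 0 z) + s *: basis_vec i.
Proof.
apply/rowP => k; rewrite !mxE !tnth_mktuple eqxx /=.
by case: eqP => _; rewrite ?mulr1 ?mulr0 ?add0r ?addr0.
Qed.

Lemma continuous_line i y : continuous (fun s : R => y + s *: basis_vec i).
Proof.
move=> s; apply: cvgD; first exact: cvg_cst.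
by apply: cvgZr_tmp; exact: cvg_id.
Qed.

Lemma is_derive_line i y (s : R) (F : 'rV[R]_d -> R) l :
  is_derive (y + s *: basis_vec i) (basis_vec i) F l ->
  is_derive s 1 (fun u => F (y + u *: basis_vec i)) l.
Proof.
move=> [dF <-].
have E : (fun h : R => h^-1 *: ((F \o shift (y + s *: basis_vec i)) (h *: basis_vec i) -
     F (y + s *: basis_vec i))) =
  (fun h : R => h^-1 *: (((fun u : R => F (y + u *: basis_vec i)) \o shift s) (h *: (1:R)) -
     F (y + s *: basis_vec i))).
  apply/funext => h /=; congr (_ *: (F _ - _)).
  by rewrite [h *: (1 : R)]mulr1 scalerDl addrCA.
by split; [move: dF; rewrite /derivable|rewrite /derive]; rewrite E.
Qed.

Lemma line_FTC i y (F F' : 'rV[R]_d -> R) (a b : R) : a < b ->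
  (forall s, s \in `[a, b] -> is_derive (y + s *: basis_vec i) (basis_vec i) F
     (F' (y + s *: basis_vec i))) ->
  (forall s, s \in `[a, b] -> {for y + s *: basis_vec i, continuous F'}) ->
  \int[leb]_(s in `[a, b]) F' (y + s *: basis_vec i) =
    F (y + b *: basis_vec i) - F (y + a *: basis_vec i).
Proof.
move=> ab dF cF'.
have dG s : s \in `[a, b] -> is_derive s 1 (fun u => F (y + u *: basis_vec i))
    (F' (y + s *: basis_vec i)).
  by move=> /dF; exact: is_derive_line.
have cG s : s \in `[a, b] -> {for s, continuous (fun u : R => F (y + u *: basis_vec i))}.
  by move=> /dG[dGs _]; apply/differentiable_continuous/derivable1_diffP.
rewrite /Rintegral (@continuous_FTC2 R _ (fun u => F (y + u *: basis_vec i)))//.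
- apply: continuous_in_subspaceT => s; rewrite inE => sab.
  apply: (@continuous_comp _ _ _ (fun s : R => y + s *: basis_vec i) F').
    exact: continuous_line.
  exact: cF'.
- split.
  + by move=> s /subset_itv_oo_cc/dG[].
  + by apply: cvg_at_right_filter; apply: cG; rewrite in_itv/= lexx ltW.
  + by apply: cvg_at_left_filter; apply: cG; rewrite in_itv/= lexx ltW.
- by move=> s /subset_itv_oo_cc/dG[? <-]; rewrite derive1E.
Qed.

End LineIntegrals.

(** * Integration by parts for compactly supported fields *)

Section C1.
Context {R : realType} {d : nat}.
Notation leb := (@lebesgue_measure R).
Implicit Types (x y : 'rV[R]_d) (i : 'I_d) (Omega U : set 'rV[R]_d).

(** The derivative is carried along explicitly, as a function that is meaningful
    on [U] only.  One direction at a time is enough: a divergence involves the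
    derivative of each component in its own direction only. *)
Definition C1_along U i (f f' : 'rV[R]_d -> R) := forall x, U x ->
  [/\ {for x, continuous f}, is_derive x (basis_vec i) f (f' x) &
      {for x, continuous f'}].

Lemma C1_alongM U i f f' g g' : C1_along U i f f' -> C1_along U i g g' ->
  C1_along U i (fun x => f x * g x) (fun x => f x * g' x + g x * f' x).
Proof.
move=> Cf Cg x Ux; have [cf df cf'] := Cf _ Ux; have [cg dg cg'] := Cg _ Ux.
split; [exact: continuousM|exact: is_deriveM|].
by apply: continuousD; exact: continuousM.
Qed.

Lemma C1_along_near U i f f' g g' : C1_along U i f f' ->
  (forall x, U x -> \forall y \near x, f y = g y /\ f' y = g' y) ->
  C1_along U i g g'.
Proof.
move=> Cf fg x Ux; have [cf df cf'] := Cf _ Ux.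
have fgx : \near x, f x = g x by apply: filterS (fg x Ux) => y [].
have fgx' : \near x, f' x = g' x by apply: filterS (fg x Ux) => y [].
split.
- change (g @ x --> g x); rewrite -(nbhs_singleton fgx).
  by apply: cvg_trans cf; exact: near_eq_cvg fgx.
- by rewrite -(nbhs_singleton fgx'); exact: near_eq_is_derive fgx df.
- change (g' @ x --> g' x); rewrite -(nbhs_singleton fgx').
  by apply: cvg_trans cf'; exact: near_eq_cvg fgx'.
Qed.

Lemma C1_along_cst U i c : C1_along U i (cst c) (cst 0).
Proof. by move=> x _; split; [exact: cst_continuous|exact: is_derive_cst|exact: cst_continuous]. Qed.

Lemma is_derive_near0 i (f : 'rV[R]_d -> R) x l : (\near x, f x = 0) ->
  is_derive x (basis_vec i) f l -> l = 0.
Proof.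
move=> f0 df; have d0 : is_derive x (basis_vec i) f 0.
  apply: (near_eq_is_derive _ (is_derive_cst (0 : R) x (basis_vec i))).
  by apply: filterS f0.
by rewrite -(@derive_val _ _ _ _ _ _ _ df) (@derive_val _ _ _ _ _ _ _ d0).
Qed.

Lemma ler_coord_norm x i : `|x 0 i| <= `|x|.
Proof.
have /mapP[j Hj ->] : `|x 0 i| \in [seq `|x k.1 k.2| | k : 'I_1 * 'I_d].
  by apply/mapP; exists (0, i) => //=; rewrite mem_enum.
by rewrite [leRHS]/Num.Def.normr /= mx_normrE; apply/bigmax_geP; right => /=; exists j.
Qed.

Lemma bounded_set_itv Omega : bounded_set Omega ->
  exists2 b : R, 0 <= b & forall x, Omega x -> forall k, x 0 k \in `[- b, b].
Proof.
move=> [M [_ HM]]; exists (`|M| + 1); first by rewrite addr_ge0.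
move=> x Ox k; rewrite in_itv/= -ler_norml (le_trans (ler_coord_norm x k))//.
by apply: HM => //; rewrite ltr_pwDr// ler_norm.
Qed.

Lemma box_row (b : R) (z : d.-tuple (measurableTypeR R)) :
  box b z <-> (forall k, row_of_tuple z 0 k \in `[- b, b]).
Proof. by split=> bz k; have := bz k; rewrite mxE. Qed.

Lemma compact_within_bounded (T : topologicalType) (A : set T) (f : T -> R) :
  compact A -> {within A, continuous f} ->
  exists2 K, 0 <= K & forall t, A t -> `|f t| <= K.
Proof.
move=> cA cf.
have [K [_ HK]] := compact_bounded (continuous_compact cf cA).
exists (`|K| + 1); first by rewrite addr_ge0.
by move=> t At; apply: (HK (`|K| + 1)); [rewrite ltr_pwDr// ler_norm|exists t].
Qed.

Lemma continuous_box_bounded (b : R) (f : 'rV[R]_d -> R) : continuous f ->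
  (forall x, ~ (forall k, x 0 k \in `[- b, b]) -> f x = 0) ->
  exists M, box_bounded b M (f \o @row_of_tuple R d).
Proof.
move=> cf f0.
have cbox : compact [set x : 'rV[R]_d | forall k, x ord0 k \in `[- b, b]].
  apply: (@rV_compact _ _ (fun=> `[- b, b]%classic)) => _.
  exact: segment_compact.
have [M M0 HM] := compact_within_bounded cbox (continuous_subspaceT cf).
exists M; split.
- rewrite -(preimage_setT (@row_of_tuple R d)).
  by apply: (@measurable_fun_open _ _ setT f openT) => x _; exact: cf.
- move=> z /=.
  have [bz|/f0->] := pselect (forall k, row_of_tuple z 0 k \in `[- b, b]).
    exact: HM.
  by rewrite normr0.
- by move=> z bz /=; apply: f0 => bz'; apply: bz; apply/box_row.
Qed.

(** Every line integral of [F'] vanishes, by the fundamental theorem of calculus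
    between two end points outside of the support. *)
Lemma Rintegral_partial0 i (F F' : 'rV[R]_d -> R) (b : R) : 0 <= b ->
  C1_along setT i F F' ->
  (forall x, ~ (forall k, x 0 k \in `[- b, b]) -> F x = 0 /\ F' x = 0) ->
  (lebesgue_tuple d).-integrable setT (EFin \o (F' \o @row_of_tuple R d)) /\
  \int[lebesgue_tuple d]_z F' (row_of_tuple z) = 0.
Proof.
move=> b0 CF F0.
have cF' : continuous F' by move=> x; have [] := CF x I.
have [M bF'] := continuous_box_bounded cF' (fun x bx => (F0 x bx).2).
split; first exact: integrable_box_bounded bF'.
apply/eqP; rewrite -normr_le0.
rewrite -(mul0r ((b *+ 2) ^+ d.-1)).
apply: (Rintegral_slice_le (i := i) b0 bF') => z /=.
under eq_Rintegral do rewrite row_set_coord.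
set y := row_of_tuple _.
have yi : y 0 i = 0 by rewrite mxE tnth_mktuple eqxx.
have out (s : R) : ~ s \in `[- b, b] -> ~ (forall k, (y + s *: basis_vec i) 0 k \in `[- b, b]).
  move=> bs /(_ i); rewrite mxE yi !mxE !eqxx add0r mulr1.
  exact: bs.
have b1 : - (b + 1) < b + 1 by lra.
have -> : \int[leb]_s F' (y + s *: basis_vec i) =
    \int[leb]_(s in `[- (b + 1), b + 1]) F' (y + s *: basis_vec i).
  rewrite [RHS]Rintegral_mkcond; apply: eq_Rintegral => s _; rewrite patchE.
  case: ifPn => //; rewrite notin_setE /= => bs.
  apply: (F0 _ (out _ _)).2; move: bs; rewrite !in_itv/= => bs ?; apply: bs; lra.
have dF s : s \in `[- (b + 1), b + 1] -> is_derive (y + s *: basis_vec i)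
    (basis_vec i) F (F' (y + s *: basis_vec i)).
  by move=> _; have [] := CF (y + s *: basis_vec i) I.
rewrite (line_FTC b1 dF (fun s _ => cF' _)).
rewrite (F0 _ (out (b + 1) _)).1 ?(F0 _ (out (- (b + 1)) _)).1 ?subrr ?normr0//.
  by rewrite in_itv/= => /andP[]; lra.
by rewrite in_itv/= => /andP[]; lra.
Qed.

Definition integral_over Omega (f : 'rV[R]_d -> R) : R :=
  \int[lebesgue_tuple d]_(z in @row_of_tuple R d @^-1` Omega) f (row_of_tuple z).

Lemma integral_overE Omega f :
  integral_over Omega f = \int[lebesgue_tuple d]_z (f \_ Omega) (row_of_tuple z).
Proof.
rewrite /integral_over Rintegral_mkcond; apply: eq_Rintegral => z _.
by rewrite !patchE; case: ifPn; rewrite ?(inE,notin_setE) => /= h; rewrite ?mem_set// memNset.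
Qed.

Lemma Rintegral_sum (I : eqType) (s : seq I) (dT : measure_display)
    (T : measurableType dT) (mu : {measure set T -> \bar R}) (D : set T)
    (f : I -> T -> R) :
  measurable D -> (forall k, k \in s -> mu.-integrable D (EFin \o f k)) ->
  mu.-integrable D (EFin \o (fun t => \sum_(k <- s) f k t)) /\
  \int[mu]_(t in D) (\sum_(k <- s) f k t) = \sum_(k <- s) \int[mu]_(t in D) f k t.
Proof.
move=> mD; elim: s => [|k s IHs] intf.
  split; last by rewrite big_nil; under eq_Rintegral do rewrite big_nil;
    rewrite Rintegral_cst// mul0r.
  rewrite [X in _.-integrable D X](_ : _ = cst 0%E); first exact: integrable0.
  by apply/funext => t /=; rewrite big_nil.
have ik := intf k (mem_head k s).
have [l ls|IHi IH] := IHs; first by apply: intf; rewrite in_cons ls orbT.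
have E : (fun t => \sum_(l <- k :: s) f l t) =
    (fun t => f k t + \sum_(l <- s) f l t) by apply/funext => t; rewrite big_cons.
rewrite E big_cons RintegralD// IH; split => //.
exact: (integrableD mD ik IHi).
Qed.

(** Integration by parts without boundary term: [tau] vanishes near the boundary,
    so that the extension of [tau * g] by zero is differentiable everywhere. *)
Lemma integral_div_cut0 Omega tau (tau' g g' : 'I_d -> 'rV[R]_d -> R) :
  open Omega -> bounded_set Omega ->
  (forall i, C1_along Omega i tau (tau' i)) ->
  (forall i, C1_along Omega i (g i) (g' i)) ->
  (forall x, ~ Omega x -> \forall y \near x, Omega y -> tau y = 0) ->
  integral_over Omega
    (fun x => \sum_(i < d) (tau x * g' i x + g i x * tau' i x)) = 0.
Proof.
move=> oO bO Ct Cg t0; have [b b0 hb] := bounded_set_itv bO.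
pose F i := (fun x => tau x * g i x) \_ Omega.
pose F' i := (fun x => tau x * g' i x + g i x * tau' i x) \_ Omega.
have CF i : C1_along setT i (F i) (F' i).
  move=> x _; have [Ox|Ox] := pselect (Omega x).
    suff : C1_along Omega i (F i) (F' i) by apply.
    apply: (C1_along_near (C1_alongM (Ct i) (Cg i))) => z Oz.
    near=> w; have Ow : Omega w by near: w; exact: open_nbhs_nbhs.
    by rewrite /F /F' !patchE mem_set.
  suff : C1_along (~` Omega) i (F i) (F' i) by apply.
  apply: (C1_along_near (@C1_along_cst _ i 0)) => z Oz.
  have /near_join tz := t0 z Oz; near=> w.
  have tw : \forall y \near w, Omega y -> tau y = 0 by near: w.
  rewrite /F /F' !patchE /=; case: ifPn => //; rewrite inE => Ow.
  have [ct dt ct'] := Ct i w Ow.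
  have -> : tau' i w = 0.
    apply: is_derive_near0 dt; apply: filterS2 (open_nbhs_nbhs (conj oO Ow)) tw.
    by move=> u Ou; exact.
  by rewrite (nbhs_singleton tw Ow) !mul0r mulr0 addr0.
have F0 i x : ~ (forall k, x 0 k \in `[- b, b]) -> F i x = 0 /\ F' i x = 0.
  by move=> bx; rewrite /F /F' !patchE memNset// => /hb.
have FI i := Rintegral_partial0 b0 (CF i) (F0 i).
rewrite integral_overE.
transitivity (\int[lebesgue_tuple d]_z \sum_(i < d) F' i (row_of_tuple z)).
  apply: eq_Rintegral => z _; rewrite patchE /F'.
  under [in RHS]eq_bigr do rewrite patchE.
  by case: ifPn => // _; rewrite big1.
have [_ ->] := @Rintegral_sum _ (index_enum 'I_d) _ _ (lebesgue_tuple d) setT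
  (fun i z => F' i (row_of_tuple z)) measurableT (fun i _ => (FI i).1).
by apply: big1 => i _; exact: (FI i).2.
Unshelve. all: by end_near. Qed.

End C1.

(** * Cut-off profiles *)

Section Profiles.
Context {R : realType}.
Implicit Types s : R.

(** A remainder of order h^2 gives the derivative of a piecewise quadratic
    function at its junction without any case distinction. *)
Lemma is_derive_quadratic (f : R -> R) (l K s : R) :
  (forall h, `|f (h + s) - f s - l * h| <= K * h ^+ 2) -> is_derive s 1 f l.
Proof.
move=> fq; suff cf : h^-1 *: (f (h *: 1 + s) - f s) @[h --> 0^'] --> l.
  by split; [apply/cvg_ex; exists l|exact/cvg_lim].
apply/subr_cvg0; apply/norm_cvg0P => /=.
apply: (@squeeze_cvgr _ _ _ _ (cst 0) (fun h : R => K * `|h|)).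
- near=> h; rewrite normr_ge0 /=.
  have h0 : h != 0 by near: h; exact: nbhs_dnbhs_neq.
  rewrite -(ler_pM2r (x := `|h|)) ?normr_gt0// -normrM.
  rewrite [h *: 1]mulr1 mulrBl /GRing.scale/= mulrAC mulVf// mul1r.
  by rewrite (le_trans (fq h))// -mulrA -normrM -expr2 ger0_norm// sqr_ge0.
- exact: cvg_cst.
- rewrite -[X in _ --> X](mulr0 K); apply: cvgM; first exact: cvg_cst.
  rewrite -[X in _ --> X](@normr0 R R); apply: cvg_norm.
  exact: cvg_within.
Unshelve. all: by end_near. Qed.

(** The positive part squared is the basic C^1 function with a flat side; the
    profiles below are all built from it. *)
Definition posq s : R := Num.max 0 s ^+ 2.
Definition dposq s : R := 2 * Num.max 0 s.

Lemma is_derive_posq s : is_derive s 1 posq (dposq s).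
Proof.
apply: (@is_derive_quadratic _ _ 1) => h; rewrite /posq /dposq mul1r ler_norml.
have [hs|hs] := leP 0 (h + s); have [s0|s0] := leP 0 s; apply/andP; split; nra.
Qed.

Lemma continuous_dposq : continuous dposq.
Proof.
move=> s; apply: cvgM; first exact: cvg_cst.
apply: continuous_max; [exact: cst_continuous|exact: cvg_id].
Qed.

(** A nondecreasing C^1 transition from 0, for s <= 0, to 1, for s >= 1. *)
Definition step s : R := 1 - posq (1 - posq s).
Definition dstep s : R := dposq (1 - posq s) * dposq s.

Lemma is_derive_step s : is_derive s 1 step (dstep s).
Proof.
have [d1 e1] := is_derive_posq s; have [d2 e2] := is_derive_posq (1 - posq s).
have dg : is_derive s 1 (fun u => 1 - posq u) (- dposq s).
  rewrite -[- dposq s]add0r.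
  exact: (@is_deriveB R R R (cst (1:R)) posq s 1 0 _ (is_derive_cst _ _ _) (is_derive_posq s)).
have dc : is_derive s 1 (posq \o (fun u => 1 - posq u)) (dposq (1 - posq s) * - dposq s).
  exact: is_derive1_comp.
rewrite (_ : dstep s = 0 - (dposq (1 - posq s) * - dposq s)); last first.
  by rewrite sub0r mulrN opprK.
exact: (@is_deriveB R R R (cst (1:R)) _ s 1 0 _ (is_derive_cst _ _ _) dc).
Qed.

Lemma continuous_dstep : continuous dstep.
Proof.
have cposq : continuous posq.
  move=> s; have [/derivable1_diffP/differentiable_continuous] := is_derive_posq s.
  exact.
move=> s; apply: cvgM; last exact: continuous_dposq.
apply: (@continuous_comp _ _ _ (fun s => 1 - posq s) dposq); last exact: continuous_dposq.
by apply: cvgB; [exact: cvg_cst|exact: cposq].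
Qed.

Lemma step_le0 s : s <= 0 -> step s = 0.
Proof.
move=> s0; rewrite /step /posq (max_l s0) expr0n/= subr0.
by rewrite max_r// expr1n subrr.
Qed.

Lemma step_ge1 s : 1 <= s -> step s = 1.
Proof.
move=> s1; rewrite /step /posq (max_r (y := s)); last lra.
by rewrite max_l ?expr0n/= ?subr0//; nra.
Qed.

Lemma step01 s : 0 <= step s <= 1.
Proof.
rewrite /step /posq; have [s0|s0] := leP 0 s; last first.
  rewrite expr0n/= subr0 max_r// expr1n subrr; lra.
by have [h|h] := leP 0 (1 - s ^+ 2); nra.
Qed.

Lemma dstep_ge0 s : 0 <= dstep s.
Proof. by rewrite !mulr_ge0// le_max lexx. Qed.

Lemma dstep_eq0 s : ~~ (0 < s < 1) -> dstep s = 0.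
Proof.
rewrite negb_and -!leNgt => /orP[s0|s1]; rewrite /dstep /dposq.
  by rewrite (max_l s0) !mulr0.
rewrite /posq (max_r (y := s)); last lra.
by rewrite max_l ?mulr0 ?mul0r//; nra.
Qed.

End Profiles.

(** * Calculus of directional derivatives, and integrals over an open set *)

Section Calculus.
Context {R : realType} {d : nat}.
Implicit Types (x y : 'rV[R]_d) (i : 'I_d) (Omega U : set 'rV[R]_d).

Lemma is_derive_dirE (x v : 'rV[R]_d) (f : 'rV[R]_d -> R) l :
  is_derive x v f l <-> is_derive (0 : R) 1 (fun u => f (x + u *: v)) l.
Proof.
have E : (fun h : R => h^-1 *: ((f \o shift x) (h *: v) - f x)) =
  (fun h : R => h^-1 *: (((fun u : R => f (x + u *: v)) \o shift 0) (h *: (1:R)) -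
     f (x + 0 *: v))).
  apply/funext => h /=; congr (_ *: (f _ - f _)).
    by rewrite [h *: (1 : R)]mulr1 addr0 addrC.
  by rewrite scale0r addr0.
split=> -[df <-]; split; move: df; rewrite /derivable /derive E//.
Qed.

Lemma is_derive_dir_comp (h : R -> R) (x v : 'rV[R]_d) (f : 'rV[R]_d -> R) l l' :
  is_derive (f x) 1 h l -> is_derive x v f l' -> is_derive x v (h \o f) (l * l').
Proof.
move=> dh /is_derive_dirE df; apply/is_derive_dirE.
apply: (@is_derive1_comp _ h (fun u : R => f (x + u *: v))) => //.
by rewrite scale0r addr0.
Qed.

Lemma C1_along_comp U i (h h' : R -> R) (f f' : 'rV[R]_d -> R) :
  (forall x, U x -> is_derive (f x) 1 h (h' (f x))) ->
  (forall x, U x -> {for f x, continuous h'}) ->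
  C1_along U i f f' -> C1_along U i (h \o f) (fun x => h' (f x) * f' x).
Proof.
move=> dh ch' Cf x Ux; have [cf df cf'] := Cf x Ux.
have ch : {for f x, continuous h}.
  by have [/derivable1_diffP/differentiable_continuous] := dh x Ux.
split; [exact: continuous_comp|exact: is_derive_dir_comp (dh x Ux) df|].
by apply: continuousM => //; apply: continuous_comp => //; exact: ch'.
Qed.

Lemma C1_alongD U i f f' g g' : C1_along U i f f' -> C1_along U i g g' ->
  C1_along U i (fun x => f x + g x) (fun x => f' x + g' x).
Proof.
move=> Cf Cg x Ux; have [cf df cf'] := Cf x Ux; have [cg dg cg'] := Cg x Ux.
by split; [exact: continuousD|exact: is_deriveD|exact: continuousD].
Qed.

Lemma C1_alongS U V i f f' : V `<=` U -> C1_along U i f f' -> C1_along V i f f'.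
Proof. by move=> VU Cf x /VU; exact: Cf. Qed.

Lemma C1_along_sum (I : Type) (s : seq I) U i (f f' : I -> 'rV[R]_d -> R) :
  (forall k, C1_along U i (f k) (f' k)) ->
  C1_along U i (fun x => \sum_(k <- s) f k x) (fun x => \sum_(k <- s) f' k x).
Proof.
move=> Cf; elim: s => [|k s IH].
  apply: (C1_along_near (@C1_along_cst R d U i 0)) => x _; near=> y.
  by rewrite !big_nil.
apply: (C1_along_near (C1_alongD (Cf k) IH)) => x _; near=> y.
by rewrite !big_cons.
Unshelve. all: by end_near. Qed.

Lemma C1_along_coord U i k :
  C1_along U i (fun x => x 0 k) (cst (i == k)%:R).
Proof.
move=> x _; split; [exact: coord_continuous| |exact: cst_continuous].
apply/is_derive_dirE.
rewrite (_ : (fun u => _) = (fun u : R => x 0 k + u * (i == k)%:R)); last first.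
  by apply/funext => u; rewrite !mxE eqxx eq_sym.
apply: (@is_derive_quadratic _ _ _ 0) => h.
rewrite [X in `|X|](_ : _ = 0) ?normr0 ?mul0r//; ring.
Qed.

End Calculus.

Section IntegralOver.
Context {R : realType} {d : nat}.
Implicit Types (x y : 'rV[R]_d) (i : 'I_d) (Omega U : set 'rV[R]_d).

Lemma finite_measure_bounded Omega : open Omega -> bounded_set Omega ->
  (lebesgue_tuple d (@row_of_tuple R d @^-1` Omega) < +oo)%E.
Proof.
move=> oO /bounded_set_itv[b b0 hb].
apply: (@le_lt_trans _ _ (lebesgue_tuple d (box b))).
  apply: le_measure; rewrite ?inE.
  - exact: measurable_open_tuple.
  - exact: measurable_box.
  - by move=> z /= /hb; rewrite box_row.
by rewrite lebesgue_box// ltry.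
Qed.

Definition integrable_over Omega (f : 'rV[R]_d -> R) :=
  (lebesgue_tuple d).-integrable (@row_of_tuple R d @^-1` Omega)
    (EFin \o (f \o @row_of_tuple R d)).

Lemma bounded_integrable_over Omega (f : 'rV[R]_d -> R) (M : R) :
  open Omega -> bounded_set Omega ->
  (forall x, Omega x -> {for x, continuous f}) ->
  (forall x, Omega x -> `|f x| <= M) -> integrable_over Omega f.
Proof.
move=> oO bO cf fM; apply: measurable_bounded_integrable.
- exact: measurable_open_tuple.
- exact: finite_measure_bounded.
- exact: measurable_fun_open.
- by exists M; split => [|y My z Oz /=]; rewrite ?num_real// (le_trans (fM _ _))// ltW.
Qed.

Lemma dominated_integral_over Omega (f : nat -> 'rV[R]_d -> R) (g : 'rV[R]_d -> R) (M : R) :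
  open Omega -> bounded_set Omega ->
  (forall n x, Omega x -> {for x, continuous (f n)}) ->
  (forall x, Omega x -> {for x, continuous g}) ->
  (forall n x, Omega x -> `|f n x| <= M) ->
  (forall x, Omega x -> f n x @[n --> \oo] --> g x) ->
  integral_over Omega (f n) @[n --> \oo] --> integral_over Omega g.
Proof.
move=> oO bO cf cg fM fg; pose D := @row_of_tuple R d @^-1` Omega.
have mD : measurable D by exact: measurable_open_tuple.
have iM : (lebesgue_tuple d).-integrable D (cst M%:E).
  apply: (@bounded_integrable_over Omega (cst M) `|M|) => // x _.
  exact: cst_continuous.
have mE (h : 'rV[R]_d -> R) : (forall x, Omega x -> {for x, continuous h}) ->
    measurable_fun D (fun z => (h (row_of_tuple z))%:E).
  by move=> ch; apply/measurable_EFinP; exact: (measurable_fun_open oO ch).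
have fgE z : D z -> (f n (row_of_tuple z))%:E @[n --> \oo] --> (g (row_of_tuple z))%:E.
  by move=> Dz; apply/fine_cvgP; split; [exact: nearW|exact: fg].
have [ig _ +] := @dominated_convergence _ _ _ (lebesgue_tuple d) D mD
  (fun n z => (f n (row_of_tuple z))%:E) (fun z => (g (row_of_tuple z))%:E) (cst M%:E)
  (fun n => mE _ (cf n)) (mE _ cg) (aeW _ fgE) iM
  (aeW _ (fun z n Dz => fM n _ Dz)).
rewrite [X in _ --> X -> _](_ : _ = (integral_over Omega g)%:E).
  by move=> /fine_cvg.
by rewrite /integral_over /Rintegral fineK// integrable_fin_num.
Qed.

Lemma integral_overD Omega f g : open Omega ->
  integrable_over Omega f -> integrable_over Omega g ->
  integral_over Omega (fun x => f x + g x) =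
  integral_over Omega f + integral_over Omega g.
Proof. by move=> oO If Ig; apply: RintegralD => //; exact: measurable_open_tuple. Qed.

Lemma integral_over_sum (I : eqType) (s : seq I) Omega (f : I -> 'rV[R]_d -> R) :
  open Omega -> (forall k, k \in s -> integrable_over Omega (f k)) ->
  integral_over Omega (fun x => \sum_(k <- s) f k x) =
  \sum_(k <- s) integral_over Omega (f k).
Proof.
move=> oO If; have mD := measurable_open_tuple oO.
by have [_] := @Rintegral_sum _ I s _ _ (lebesgue_tuple d) _ (fun k z => f k (row_of_tuple z)) mD If.
Qed.

Lemma eq_integral_over Omega f g : (forall x, Omega x -> f x = g x) ->
  integral_over Omega f = integral_over Omega g.
Proof. by move=> fg; apply: eq_Rintegral => z; rewrite inE => /fg. Qed.

End IntegralOver.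

(** * Boundary layers have bounded mass *)

Section Strip.
Context {R : realType} {d : nat}.
Notation leb := (@lebesgue_measure R).
Implicit Types (x y : 'rV[R]_d) (i j : 'I_d) (Omega U : set 'rV[R]_d).

Definition closed_cube x0 (r : R) : set 'rV[R]_d :=
  [set x | forall k, x 0 k \in `[x0 0 k - r, x0 0 k + r]].

Lemma measurable_closed_cube x0 r : measurable (@row_of_tuple R d @^-1` closed_cube x0 r).
Proof.
rewrite (_ : _ @^-1` _ =
    [set z | forall i, `[x0 0 i - r, x0 0 i + r]%classic (tnth z i)]).
  apply: (@measurable_coordwise R d
    (fun i => `[x0 0 i - r, x0 0 i + r]%classic)) => i.
  exact: measurable_itv.
by apply/seteqP; split => z xz i; have := xz i; rewrite /= mxE.
Qed.

Lemma compact_closed_cube x0 r : compact (closed_cube x0 r).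
Proof.
apply: (@rV_compact _ _ (fun k => `[x0 0 k - r, x0 0 k + r]%classic)) => k.
exact: segment_compact.
Qed.

Lemma closed_cube_sub_ball x0 r e : r < e -> 0 < e -> closed_cube x0 r `<=` ball x0 e.
Proof.
move=> re e0 x xc; apply/(ball_rVP _ _ e0) => k.
rewrite distrC; apply: le_lt_trans re; have := xc k.
by rewrite in_itv/= ler_distl.
Qed.

Lemma ball_sub_closed_cube x0 r : ball x0 r `<=` closed_cube x0 r.
Proof.
move=> x xc; have r0 : 0 < r by case: xc.
move=> k; move: xc => /(ball_rVP _ _ r0)/(_ k)/ltW.
by rewrite distrC in_itv/= ler_distl.
Qed.

(** Along a line in direction [j] the integral of [H'] is a difference of two
    values of [H], hence at most 1, however steep [H] may be.  Applied to the
    transition function of a boundary layer, this bounds the layer uniformly in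
    its thickness. *)
Lemma integral_cube_partial_le x0 r e j (H H' : 'rV[R]_d -> R) :
  0 < r -> r < e -> C1_along (ball x0 e) j H H' ->
  (forall x, ball x0 e x -> 0 <= H x <= 1) ->
  (lebesgue_tuple d).-integrable setT
    (EFin \o ((H' \_ (closed_cube x0 r)) \o @row_of_tuple R d)) /\
  `|\int[lebesgue_tuple d]_z (H' \_ (closed_cube x0 r)) (row_of_tuple z)| <=
     ((`|x0| + r) *+ 2) ^+ d.-1.
Proof.
move=> r0 re CH H01.
have e0 : 0 < e by exact: lt_trans re.
have cE := @closed_cube_sub_ball x0 _ _ re e0.
set b := `|x0| + r; have b0 : 0 <= b by rewrite addr_ge0// ltW.
have cH' : {within closed_cube x0 r, continuous H'}.
  by apply: continuous_in_subspaceT => x; rewrite inE => /cE/CH[].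
have [M M0 HM] := compact_within_bounded (@compact_closed_cube x0 r) cH'.
have cb x : closed_cube x0 r x -> forall k, x 0 k \in `[- b, b].
  move=> xc k; have := xc k; rewrite !in_itv/= -ler_distl -ler_norml => xr.
  have := ler_coord_norm x0 k; rewrite -[x 0 k](subrK (x0 0 k)) => ?.
  by rewrite (le_trans (ler_normD _ _))// addrC lerD.
have bb : box_bounded b M ((H' \_ (closed_cube x0 r)) \o @row_of_tuple R d).
  split.
  - have -> : (H' \_ (closed_cube x0 r)) \o @row_of_tuple R d =
       (H' \o @row_of_tuple R d) \_ (@row_of_tuple R d @^-1` closed_cube x0 r).
      by apply/funext => z; rewrite /= !patchE /=; case: ifPn;
        rewrite ?(inE, notin_setE) => h; rewrite ?mem_set// memNset.
    apply/(measurable_restrictT _ (measurable_closed_cube x0 r)).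
    have oB : open (ball x0 e : set 'rV[R]_d) by exact: ball_open.
    apply: (measurable_funS _ _ (measurable_fun_open oB _)).
    + exact: measurable_open_tuple.
    + by move=> z /= /cE.
    + by move=> x /CH[].
  - move=> z /=; rewrite patchE; case: ifPn => [|_]; rewrite ?normr0//.
    by rewrite inE; exact: HM.
  - move=> z nbz /=; rewrite patchE memNset// => cz; apply: nbz; apply/box_row.
    exact: cb.
split; first exact: integrable_box_bounded bb.
rewrite -[leRHS]mul1r; apply: (Rintegral_slice_le (i := j) b0 bb) => z /=.
under eq_Rintegral do rewrite row_set_coord.
set y := row_of_tuple _.
have yj (s : R) : (y + s *: basis_vec j) 0 j = s.
  by rewrite mxE [y 0 j]mxE tnth_mktuple !mxE !eqxx add0r mulr1.
have yk (s : R) k : k != j -> (y + s *: basis_vec j) 0 k = y 0 k.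
  by move=> kj; rewrite mxE !mxE (negPf kj) /= mulr0 addr0.
have [yc|nyc] := pselect (forall k, k != j -> y 0 k \in `[x0 0 k - r, x0 0 k + r]);
    last first.
  rewrite (_ : \int[leb]_s _ = \int[leb]_s (cst 0 s)).
    by rewrite Rintegral_cst// mul0r normr0.
  apply: eq_Rintegral => s _; rewrite patchE memNset// => sc; apply: nyc => k kj.
  by rewrite -(yk s k kj); exact: sc.
have cs s : (closed_cube x0 r (y + s *: basis_vec j)) <-> s \in `[x0 0 j - r, x0 0 j + r].
  split=> [/(_ j)|sc k]; first by rewrite yj.
  by have [->|kj] := eqVneq k j; rewrite ?yj// yk//; exact: yc.
rewrite (_ : \int[leb]_s _ =
    \int[leb]_(s in `[x0 0 j - r, x0 0 j + r]) H' (y + s *: basis_vec j)); last first.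
  rewrite [RHS]Rintegral_mkcond; apply: eq_Rintegral => s _; rewrite !patchE.
  have [sc|sc] := pselect (s \in `[x0 0 j - r, x0 0 j + r]).
    by rewrite !mem_set//; apply/cs.
  by rewrite !memNset// => /cs.
have b1 : x0 0 j - r < x0 0 j + r by lra.
have in_ball s : s \in `[x0 0 j - r, x0 0 j + r] -> ball x0 e (y + s *: basis_vec j).
  by move=> /cs /cE.
have dH s : s \in `[x0 0 j - r, x0 0 j + r] -> is_derive (y + s *: basis_vec j)
    (basis_vec j) H (H' (y + s *: basis_vec j)).
  by move=> /in_ball/CH[].
have cH s : s \in `[x0 0 j - r, x0 0 j + r] ->
    {for y + s *: basis_vec j, continuous H'}.
  by move=> /in_ball/CH[].
rewrite (line_FTC b1 dH cH).
have := H01 _ (in_ball (x0 0 j - r) _); rewrite in_itv/= lexx ltW// => /(_ isT) h1.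
have := H01 _ (in_ball (x0 0 j + r) _); rewrite in_itv/= lexx ltW// => /(_ isT) h2.
rewrite ler_norml; move: h1 h2 => /andP[? ?] /andP[? ?]; lra.
Qed.

End Strip.

(** * The divergence theorem for tangential fields *)
Lemma continuous_sum {R : realType} {T : topologicalType} (I : Type) (s : seq I)
    (f : I -> T -> R) x :
  (forall k, {for x, continuous (f k)}) ->
  {for x, continuous (fun y => \sum_(k <- s) f k y)}.
Proof.
move=> cf; apply: (@cvg_big R I +%R 0 xpredT _ T (nbhs x) s f (fun k => f k x)).
- exact: add_continuous.
- by move=> k _; exact: cf.
Qed.

Lemma near_infty_ltr_natS {R : realType} (r : R) :
  \forall n \near \oo, r < n.+1%:R.
Proof.
near=> n; apply: (@lt_le_trans _ _ n%:R); last by rewrite ler_nat.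
by near: n; exact: nbhs_infty_gtr.
Unshelve. all: by end_near. Qed.

Lemma le_normr_Rintegral_dominated {R : realType} (dT : measure_display)
    (T : measurableType dT) (mu : {measure set T -> \bar R}) (D : set T)
    (f B : T -> R) : measurable D -> measurable_fun D f ->
  (forall t, D t -> `|f t| <= B t) -> (forall t, 0 <= B t) ->
  mu.-integrable setT (EFin \o B) ->
  mu.-integrable D (EFin \o f) /\ `|\int[mu]_(t in D) f t| <= \int[mu]_t B t.
Proof.
move=> mD mf fB B0 iB; have iBD : mu.-integrable D (EFin \o B).
  exact: integrableS iB.
have if_ : mu.-integrable D (EFin \o f).
  apply: le_integrable iBD => //; first exact/measurable_EFinP.
  by move=> t Dt /=; rewrite lee_fin (ger0_norm (B0 t)) fB.
split => //; apply: (le_trans (le_normr_Rintegral mD if_)).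
apply: (@le_trans _ _ (\int[mu]_(t in D) B t)).
  by apply: le_Rintegral => //; exact: integrable_abse if_.
rewrite Rintegral_mkcond; apply: le_Rintegral => //.
  by rewrite -restrict_EFin; apply/(integrable_mkcond _ mD).
by move=> t _; rewrite patchE; case: ifP.
Qed.

Section PartitionOfUnity.
Context {R : realType} {d : nat}.
Implicit Types (x y : 'rV[R]_d) (i j : 'I_d) (U : set 'rV[R]_d).

(** A C^1 function that is positive near [x0] and vanishes off [ball x0 r]; the
    Euclidean distance keeps it differentiable. *)
Definition cap x0 (r : R) x : R :=
  posq (r ^+ 2 - \sum_(k < d) (x 0 k - x0 0 k) ^+ 2).

Lemma cap_ge0 x0 r x : 0 <= cap x0 r x.
Proof. exact: sqr_ge0. Qed.

Lemma cap_center x0 r : 0 < r -> 0 < cap x0 r x0.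
Proof.
move=> r0; rewrite /cap big1 => [|k _]; last by rewrite subrr expr0n.
rewrite subr0 /posq exprn_gt0// lt_max orbC exprn_gt0//.
Qed.

Lemma cap_out x0 r x : 0 < r -> ~ ball x0 r x -> cap x0 r x = 0.
Proof.
move=> r0 nb; rewrite /cap /posq max_l ?expr0n// subr_le0.
rewrite leNgt; apply/negP => lt; apply: nb; apply/(ball_rVP _ _ r0) => k.
rewrite distrC ltNge; apply/negP => rk; move: lt; apply/negP; rewrite -leNgt.
apply: (@le_trans _ _ ((x 0 k - x0 0 k) ^+ 2)).
  by have r0' := ltW r0; rewrite -[leRHS]real_normK ?num_real// !expr2 ler_pM.
by rewrite (bigD1 k)//= lerDl sumr_ge0// => l _; exact: sqr_ge0.
Qed.

Lemma C1_along_cap x0 r i : exists f', C1_along setT i (cap x0 r) f'.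
Proof.
have Cs k : exists f', C1_along setT i (fun x => (x 0 k - x0 0 k) ^+ 2) f'.
  have C := C1_alongD (@C1_along_coord _ _ setT i k)
    (@C1_along_cst _ _ setT i (- x0 0 k)).
  by eexists; exact: (C1_alongM C C).
have [s' Cs'] := choice Cs.
have Csum := C1_along_sum (index_enum 'I_d) Cs'.
have Cn := C1_alongM (@C1_along_cst _ _ setT i (-1)) Csum.
have Cq := C1_alongD (@C1_along_cst _ _ setT i (r ^+ 2)) Cn.
have C := @C1_along_comp _ _ setT i posq dposq _ _
  (fun x _ => is_derive_posq _) (fun x _ => @continuous_dposq R _) Cq.
eexists; apply: (C1_along_near C) => x _; near=> y; split; last exact: erefl.
by rewrite /cap /= mulN1r.
Unshelve. all: by end_near. Qed.

Lemma C1_along_inv U i f f' : (forall x, U x -> f x != 0) ->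
  C1_along U i f f' -> exists g', C1_along U i (fun x => (f x)^-1) g'.
Proof.
move=> f0 Cf; eexists.
apply: (@C1_along_comp _ _ U i (@GRing.inv R) (fun s => - s ^- 2) f f' _ _ Cf).
  move=> x /f0 fx0.
  have := @is_deriveV R id (f x) 1 1 fx0 (is_derive_id _ _).
  by rewrite [_ *: _]mulr1.
move=> x /f0 fx0; apply: continuousN; apply: continuousV.
  by rewrite expf_neq0.
exact: exprn_continuous.
Qed.

End PartitionOfUnity.

(** The boundary term is removed by cut-offs that vanish near the boundary.  With
    them, continuity of [G] and boundedness of its divergence up to the boundary
    are enough, even though single derivatives [G' i] may blow up there. *)
Section Divergence.
Context {R : realType} {d : nat}.
Implicit Types (x y : 'rV[R]_d) (i j : 'I_d) (U : set 'rV[R]_d).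

Variables (Omega : set 'rV[R]_d) (G G' : 'I_d -> 'rV[R]_d -> R) (M : R).
Hypothesis oO : open Omega.
Hypothesis bO : bounded_set Omega.
Hypothesis CG : forall i, C1_along Omega i (G i) (G' i).
Hypothesis cG : forall i, {within closure Omega, continuous (G i)}.
Hypothesis divM : forall x, Omega x -> `|\sum_(i < d) G' i x| <= M.
Hypothesis normal : forall x0 U rho, boundary Omega x0 ->
  defining_function Omega x0 U rho ->
  \sum_(i < d) G i x0 * partial i rho x0 = 0.
Hypothesis smooth : forall x0, boundary Omega x0 ->
  exists U rho, defining_function Omega x0 U rho.

(** The members of a partition of unity, localized in [ball x0 r] but with
    arbitrary values at the boundary of [Omega]: there the tangentiality of [G]
    takes the place of decay. *)
Definition test_function x0 (r : R) (theta : 'rV[R]_d -> R)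
    (theta' : 'I_d -> 'rV[R]_d -> R) : Prop :=
  [/\ forall i, C1_along Omega i theta (theta' i),
      forall x, Omega x -> `|theta x| <= 1,
      exists K, forall i x, Omega x -> `|theta' i x| <= K &
      forall x, Omega x -> ~ ball x0 r x -> theta x = 0].

(** The divergence of [theta * G] on [Omega]. *)
Definition weak_div (theta : 'rV[R]_d -> R) (theta' : 'I_d -> 'rV[R]_d -> R) x :=
  theta x * (\sum_(i < d) G' i x) + \sum_(i < d) G i x * theta' i x.

Lemma compact_closure_bounded : compact (closure Omega).
Proof.
apply: bounded_closed_compact; last exact: closed_closure.
have [b b0 hb] := bounded_set_itv bO.
exists b; split; first exact: num_real.
move=> e be x cx.
have Hb k : `|x 0 k| <= b.
  rewrite leNgt; apply/negP => bx.
  have := cx _ (_ : nbhs x [set y | b < `|y 0 k|]); case.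
    have : continuous (fun y : 'rV[R]_d => `|y 0 k|).
      move=> y; apply: (@continuous_comp _ _ _ (fun y : 'rV[R]_d => y 0 k) Num.norm).
        exact: coord_continuous.
      exact: norm_continuous.
    by move=> /(_ x) /cvgr_gt; exact.
  move=> y [Oy] /=; have := hb _ Oy k; rewrite in_itv/= -ler_norml => ?.
  by rewrite ltNge => /negP.
apply: le_trans (ltW be); rewrite /Num.Def.normr /= mx_normrE.
by apply: bigmax_le => // -[u k] _; rewrite ord1.
Qed.

Lemma C1_along_vanish x0 r theta theta' i x :
  C1_along Omega i theta (theta' i) ->
  (forall x, Omega x -> ~ ball x0 r x -> theta x = 0) ->
  Omega x -> (\forall y \near x, ~ ball x0 r y) ->
  (\forall y \near x, theta y = 0) /\ theta' i x = 0.
Proof.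
move=> Ct t0 Ox nb; have tn : \forall y \near x, theta y = 0.
  by apply: filterS2 (open_nbhs_nbhs (conj oO Ox)) nb => y; exact: t0.
by split => //; have [_ dt _] := Ct x Ox; exact: is_derive_near0 dt.
Qed.

Lemma nbhs_not_ball x0 (r e : R) x : 0 < r -> r < e -> ~ ball x0 e x ->
  \forall y \near x, ~ ball x0 r y.
Proof.
move=> r0 re nb; apply/nbhs_ballP; exists (e - r) => /=; first by rewrite subr_gt0.
move=> y xy x0y; apply: nb; rewrite -(subrK r e) addrC.
by apply: ball_triangle x0y _; exact: ball_sym.
Qed.

Lemma weak_div_eq0 x0 r e theta theta' x : test_function x0 r theta theta' ->
  0 < r -> r < e -> Omega x -> ~ ball x0 e x -> weak_div theta theta' x = 0.
Proof.
move=> [Ct _ _ t0] r0 re Ox nb; have nbr := nbhs_not_ball r0 re nb.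
rewrite /weak_div t0//; last exact: nbhs_singleton nbr.
rewrite mul0r add0r big1// => i _.
by have [_ ->] := C1_along_vanish (Ct i) t0 Ox nbr; rewrite mulr0.
Qed.

Lemma weak_div_continuous theta theta' x0 r : test_function x0 r theta theta' ->
  forall x, Omega x -> {for x, continuous (weak_div theta theta')}.
Proof.
move=> [Ct _ _ _] x Ox; apply: continuousD.
  case: (pselect (0 < d)%N) => [d0|nd].
    apply: continuousM; first by have [] := Ct (Ordinal d0) x Ox.
    by apply: continuous_sum => i; have [] := CG i Ox.
  rewrite (_ : (fun y => _) = cst 0); first exact: cst_continuous.
  apply/funext => y; rewrite big1 ?mulr0// => i _.
  by exfalso; apply: nd; exact: leq_ltn_trans (ltn_ord i).
apply: continuous_sum => i.
by apply: continuousM; [have [] := CG i Ox|have [] := Ct i x Ox].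
Qed.

Lemma weak_div_bounded theta theta' x0 r : test_function x0 r theta theta' ->
  exists K, forall x, Omega x -> `|weak_div theta theta' x| <= K.
Proof.
move=> [Ct t1 [K tK] _].
have /choice[B HB] : forall i, exists B, forall x, closure Omega x -> `|G i x| <= B.
  move=> i; have [B _ HB] := compact_within_bounded compact_closure_bounded (@cG i).
  by exists B.
exists (M + \sum_i B i * K) => x Ox.
rewrite (le_trans (ler_normD _ _))// lerD//.
  by rewrite normrM -[leRHS]mul1r ler_pM// ?t1// divM.
rewrite (le_trans (ler_norm_sum _ _ _))// ler_sum// => i _.
by rewrite normrM ler_pM// ?tK//; apply: HB; exact: subset_closure.
Qed.

Lemma local_interior x0 : Omega x0 ->
  exists2 r, 0 < r & forall theta theta', test_function x0 r theta theta' ->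
    integral_over Omega (weak_div theta theta') = 0.
Proof.
move=> Ox0; have /nbhs_ballP[e /= e0 eO] := open_nbhs_nbhs (conj oO Ox0).
have e20 : 0 < e / 2 by rewrite divr_gt0.
have e2e : e / 2 < e by lra.
exists (e / 2) => // theta theta' [Ct _ _ t0].
rewrite -[RHS](@integral_div_cut0 _ _ Omega theta theta' G G')//.
  by apply: eq_integral_over => x _; rewrite /weak_div mulr_sumr -big_split.
move=> x nOx; have nb : ~ ball x0 e x by move=> /eO.
by apply: filterS (nbhs_not_ball e20 e2e nb) => y nby Oy; exact: t0.
Qed.

Section Boundary.
Variables (x0 : 'rV[R]_d) (U : set 'rV[R]_d) (rho : 'rV[R]_d -> R).
Hypothesis bx0 : boundary Omega x0.
Hypothesis defU : defining_function Omega x0 U rho.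

Let normal_flux x := \sum_(i < d) G i x * partial i rho x.

Lemma C1_along_defining i : C1_along U i rho (partial i rho).
Proof.
have [oU _ /(_ 1%N)[crho drho] _ _] := defU.
move=> x Ux; have [dx [cx _]] := drho i; split; [exact: crho| |exact: cx].
exact/derivableP/dx.
Qed.

Lemma continuous_defining x : U x -> {for x, continuous rho}.
Proof. by have [_ _ /(_ 1%N)[crho _] _ _] := defU; exact: crho. Qed.

Lemma closure_defining_le0 x : closure Omega x -> U x -> rho x <= 0.
Proof.
have [oU _ _ _ rhoP] := defU => cx Ux; rewrite leNgt; apply/negP => rx.
have nU : nbhs x (U `&` [set y | 0 < rho y]).
  apply: filterI; first exact: open_nbhs_nbhs.
  by have /cvgr_gt := continuous_defining Ux; exact.
have [y [Oy [Uy /=]]] := cx _ nU.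
by move: Oy; rewrite rhoP// => h1 h2; have := lt_trans h1 h2; rewrite ltxx.
Qed.

Lemma normal_flux_eq0 x : closure Omega x -> U x -> 0 <= rho x -> normal_flux x = 0.
Proof.
have [oU _ Crho grho rhoP] := defU => cx Ux rx; apply: (normal (U := U)).
  by split => // /interior_subset; rewrite rhoP// ltNge rx.
by split.
Qed.

(** Uniform smallness of the normal flux near the boundary.  The minimum over a
    compact piece of the closure of [- rho + max(0, delta - |normal_flux|)] is
    positive: where [rho] vanishes so does the normal flux.  Below this minimum
    the second summand of the function cannot vanish. *)
Lemma normal_flux_small r delta : 0 < r -> closed_cube x0 r `<=` U -> 0 < delta ->
  exists2 m, 0 < m & forall x, closure Omega x -> closed_cube x0 r x -> - rho x < m ->
    `|normal_flux x| <= delta.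
Proof.
move=> r0 cU d0; pose A := closed_cube x0 r `&` closure Omega.
have cA : compact A by apply: compact_closedI; [exact: compact_closed_cube|exact: closed_closure].
pose q := fun x => - rho x + Num.max 0 (delta - `|normal_flux x|).
have cflux : {within A, continuous normal_flux}.
  move=> x; apply: (@continuous_sum R (subspace A)) => i; apply: continuousM.
    have GA : {within A, continuous (G i)}.
      by apply: continuous_subspaceW (@cG i) => y [].
    exact: GA.
  have pA : {within A, continuous (partial i rho)}.
    apply: continuous_in_subspaceT => y; rewrite inE => -[cy _].
    by have [] := C1_along_defining i (cU _ cy).
  exact: pA.
have crho : {within A, continuous rho}.
  apply: continuous_in_subspaceT => y; rewrite inE => -[cy _].
  exact: continuous_defining (cU _ cy).
have cq : {within A, continuous q}.
  move=> x; apply: cvgD; first by apply: cvgN; exact: crho.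
  apply: (@continuous_max R (subspace A) (cst 0)
    (fun y => delta - `|normal_flux y|)); first exact: cst_continuous.
  by apply: cvgB; [exact: cvg_cst|apply: cvg_norm; exact: cflux].
have q0 x : A x -> 0 < q x.
  move=> [xc xO]; have := closure_defining_le0 xO (cU _ xc).
  rewrite le_eqVlt => /predU1P[r1|r1].
    by rewrite /q r1 oppr0 add0r (normal_flux_eq0 xO (cU _ xc)) ?r1// normr0 subr0 lt_max d0 orbT.
  by rewrite /q ltr_wpDr ?oppr_gt0// le_max lexx.
have A0 : A !=set0.
  exists x0; split; last by have [] := bx0.
  by move=> k; rewrite in_itv/=; apply/andP; split; lra.
have [c cA' cmin] := compact_EVT_min A0 cA cq.
exists (q c) => [|x xO xc xq]; first by apply: q0; rewrite inE in cA'.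
rewrite leNgt; apply/negP => dN.
have := cmin x; rewrite inE => /(_ (conj xc xO)); rewrite leNgt => /negP; apply.
by rewrite {1}/q max_l ?addr0//; lra.
Qed.

(** Vanishes for - rho <= eps, is 1 for - rho >= 2 eps: the shift by 1 makes it
    vanish in a whole neighbourhood of the boundary. *)
Definition layer (eps : R) x : R := step (- rho x / eps - 1).

Definition dlayer (eps : R) i x : R :=
  dstep (- rho x / eps - 1) * (- (partial i rho x) / eps).

Lemma C1_along_layer eps i : C1_along U i (layer eps) (dlayer eps i).
Proof.
have CA := C1_alongD (C1_alongM (@C1_along_cst _ _ U i (- eps^-1))
  (C1_along_defining i)) (@C1_along_cst _ _ U i (-1)).
have := @C1_along_comp _ _ U i step dstep _ _ (fun x _ => is_derive_step _)
  (fun x _ => @continuous_dstep R _) CA.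
move=> H; apply: (C1_along_near H) => x Ux; near=> y; rewrite /layer /dlayer /=.
have -> : - eps^-1 * rho y - 1 = - rho y / eps - 1 by ring.
by split => //; congr (_ * _); ring.
Unshelve. all: by end_near. Qed.

Lemma layer_limit x : rho x < 0 -> layer n.+1%:R^-1 x @[n --> \oo] --> (1 : R).
Proof.
move=> rx; apply: cvg_near_cst; near=> n.
rewrite /layer invrK step_ge1// lerBrDr.
have : 2 / - rho x < n.+1%:R.
  by near: n; exact: near_infty_ltr_natS.
by rewrite ltr_pdivrMr ?oppr_gt0//; lra.
Unshelve. all: by end_near. Qed.

(** [f] is only controlled in the chart [ball x0 e], outside of which [a] is
    zero. *)
Lemma continuous_cut r e (a f : 'rV[R]_d -> R) : 0 < r -> r < e ->
  (forall x, Omega x -> {for x, continuous a}) ->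
  (forall x, Omega x -> ~ ball x0 r x -> a x = 0) ->
  (forall x, Omega x -> ball x0 e x -> {for x, continuous f}) ->
  forall x, Omega x -> {for x, continuous (fun y => f y * a y)}.
Proof.
move=> r0 re ca a0 cf x Ox; have [xe|nxe] := pselect (ball x0 e x).
  by apply: continuousM; [exact: cf|exact: ca].
have nb := nbhs_not_ball r0 re nxe.
have z : \near x, f x * a x = 0.
  apply: filterS2 (open_nbhs_nbhs (conj oO Ox)) nb => y Oy ny.
  by rewrite a0// mulr0.
change ((fun y => f y * a y) y @[y --> x] --> f x * a x).
rewrite (nbhs_singleton z); by apply: (@cvg_near_cst _ _ _ _ (nbhs x)); exact: z.
Qed.

(** Test with [theta * layer eps].  The error against the integral of [weak_div]
    comes from the gradient of the layer, that is, from the normal flux weighted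
    by dstep / eps; the first is small, and the second, up to the constant [c]
    that bounds a partial derivative of [rho] from below, is the derivative of
    the layer in a coordinate direction and has bounded integral. *)
Lemma local_boundary :
  exists2 r, 0 < r & forall theta theta', test_function x0 r theta theta' ->
    integral_over Omega (weak_div theta theta') = 0.
Proof.
have [oU Ux0 Crho grho rhoP] := defU.
have [j pj] : exists j, partial j rho x0 != 0.
  apply/existsP; rewrite -negb_forall; apply: contra (grho x0 Ux0) => /forallP p0.
  by apply/eqP/rowP => k; rewrite !mxE; apply/eqP/p0.
pose sg := Num.sg (partial j rho x0); pose c := `|partial j rho x0| / 2.
have c0 : 0 < c by rewrite divr_gt0// normr_gt0.
have nbU : \forall x \near x0, U x /\ c < sg * partial j rho x.
  near=> x; split; first by near: x; exact: (open_nbhs_nbhs (conj oU Ux0)).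
  near: x; have [_ _ cp] := C1_along_defining j Ux0.
  have : {for x0, continuous (fun x => sg * partial j rho x)}.
    by apply: continuousM => //; exact: cst_continuous.
  move=> /cvgr_gt; apply; rewrite -normrEsg /c.
  have : 0 < `|partial j rho x0| by rewrite normr_gt0.
  lra.
(* sg gives the partial derivative of rho a fixed sign on the whole chart *)
have /nbhs_ballP[e /= e0 eU] := nbU.
have sg1 : `|sg| = 1 by rewrite normr_sg pj.
pose r := e / 3.
have r0 : 0 < r by rewrite divr_gt0.
exists r => // theta theta' T.
have r2r : r < 2 * r by lra.
have r2e : 2 * r < e by rewrite /r; lra.
have re : r < e by lra.
have cubeU : closed_cube x0 r `<=` U by move=> x /(closed_cube_sub_ball re e0)/eU[].
have [Ct t1 [Kt tK] t0] := T.
have [W HW] := weak_div_bounded T.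
have cw := weak_div_continuous T.
have w0 x : Omega x -> ~ ball x0 (2 * r) x -> weak_div theta theta' x = 0.
  by move=> Ox; exact: weak_div_eq0 T r0 r2r Ox.
have clayer eps x : ball x0 e x -> {for x, continuous (layer eps)}.
  by move=> /eU[Ux _]; have [] := C1_along_layer eps j Ux.
have cdlayer eps i x : ball x0 e x -> {for x, continuous (dlayer eps i)}.
  by move=> /eU[Ux _]; have [] := C1_along_layer eps i Ux.
pose K := ((`|x0| + r) *+ 2) ^+ d.-1.
have K0 : 0 <= K by rewrite exprn_ge0// mulrn_wge0// addr_ge0// ltW.
have layer01 eps x : 0 <= layer eps x <= 1 by exact: step01.
have main delta : 0 < delta -> \forall n \near \oo,
    `|integral_over Omega (fun x => layer n.+1%:R^-1 x * weak_div theta theta' x)| <=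
    delta / c * K.
  move=> d0; have [m m0 Hm] := normal_flux_small r0 cubeU d0.
  near=> n; set eps := n.+1%:R^-1.
  have eps0 : 0 < eps by rewrite invr_gt0.
  have epsm : 2 * eps < m.
    have : 2 / m < n.+1%:R by near: n; exact: near_infty_ltr_natS.
    by rewrite /eps ltr_pdivrMr// ltr_pdivrMr// => ?; rewrite mulrC.
  pose tau x := theta x * layer eps x.
  pose tau' i x := theta x * dlayer eps i x + layer eps x * theta' i x.
  have Ctau i : C1_along Omega i tau (tau' i).
    move=> x Ox; have [xe|nxe] := pselect (ball x0 e x).
      have C1 : C1_along (Omega `&` U) i tau (tau' i).
        apply: C1_alongM; first by apply: C1_alongS (Ct i) => y [].
        by apply: C1_alongS (C1_along_layer eps i) => y [].
      by apply: C1; split => //; have [] := eU _ xe.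
    have C0 : C1_along (Omega `&` ~` ball x0 e) i tau (tau' i).
      apply: (C1_along_near (@C1_along_cst _ _ _ i 0)) => y [Oy nye].
      have nb := nbhs_not_ball r0 re nye.
      near=> z; have Oz : Omega z by near: z; exact: (open_nbhs_nbhs (conj oO Oy)).
      have /= nbz : \forall u \near z, ~ ball x0 r u.
        by near: z; exact: (near_join nb).
      have [tz tz'] := C1_along_vanish (Ct i) t0 Oz nbz.
      by rewrite /tau /tau' tz' (nbhs_singleton tz) !mul0r mulr0 addr0.
    exact: C0.
  have cut0 : integral_over Omega
      (fun x => \sum_(i < d) (tau x * G' i x + G i x * tau' i x)) = 0.
    apply: integral_div_cut0 => // x nOx.
    have [xe|nxe] := pselect (ball x0 e x); last first.
      by apply: filterS (nbhs_not_ball r0 re nxe) => y ny Oy; rewrite /tau t0// mul0r.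
    have [Ux _] := eU _ xe.
    have rx : - eps < rho x.
      have : 0 <= rho x by rewrite leNgt; apply/negP => /(rhoP _ Ux).
      lra.
    have /cvgr_gt/(_ _ rx) := continuous_defining Ux; apply: filterS => y ry Oy.
    rewrite /tau /layer step_le0 ?mulr0// subr_le0 ler_pdivrMr// mul1r; lra.
  (* the contribution of the gradient of the layer *)
  pose E x := theta x * \sum_(i < d) G i x * dlayer eps i x.
  have cutE x : \sum_(i < d) (tau x * G' i x + G i x * tau' i x) =
      layer eps x * weak_div theta theta' x + E x.
    rewrite /weak_div /E /tau /tau' mulr_sumr -big_split/= !mulr_sumr -big_split/=.
    by apply: eq_bigr => i _; ring.
  have Esmall x : Omega x -> ball x0 r x -> `|E x| <=
      delta / c * (- sg * dlayer eps j x).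
    move=> Ox xr; have xc := ball_sub_closed_cube xr.
    have xe : ball x0 e x by exact: closed_cube_sub_ball xc.
    have [Ux xp] := eU _ xe.
    rewrite /E normrM -[leRHS]mul1r ler_pM ?t1//.
    rewrite (_ : \sum_(i < d) _ = - (dstep (- rho x / eps - 1) / eps) * normal_flux x); last first.
      by rewrite /normal_flux mulr_sumr; apply: eq_bigr => i _; rewrite /dlayer; ring.
    rewrite normrM normrN [`|dstep _ / _|]ger0_norm; last by rewrite divr_ge0 ?dstep_ge0// ltW.
    rewrite (_ : _ * (- sg * _) = dstep (- rho x / eps - 1) / eps *
       (delta / c * (sg * partial j rho x))); last by rewrite /dlayer; ring.
    have [s01|/dstep_eq0->] := boolP (0 < - rho x / eps - 1 < 1); last by rewrite !mul0r.
    apply: ler_wpM2l; first by rewrite divr_ge0 ?dstep_ge0// ltW.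
    apply: (@le_trans _ _ delta).
      apply: Hm => //; first exact: subset_closure.
      move: s01 => /andP[_]; rewrite ltrBlDr ltr_pdivrMr// => ?; lra.
    by rewrite mulrAC ler_pdivlMr// ler_pM2l// ltW.
  have E0 x : Omega x -> ~ ball x0 r x -> E x = 0.
    by move=> Ox nb; rewrite /E t0// mul0r.
  have [iD leD] := integral_cube_partial_le r0 re
    (C1_alongS (fun x xe => (eU x xe).1) (@C1_along_layer eps j))
    (fun x _ => layer01 eps x).
  (* B extends the bound on E to all of space, where its line integrals in
     direction j are those of a derivative *)
  pose B (z : d.-tuple (measurableTypeR R)) : R :=
    delta / c * - sg * ((dlayer eps j) \_ (closed_cube x0 r)) (row_of_tuple z).
  have iB : (lebesgue_tuple d).-integrable setT (EFin \o B).
    exact: (integrableZl measurableT (delta / c * - sg) iD).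
  have B0 z : 0 <= B z.
    rewrite /B patchE; case: ifPn => [|_]; last by rewrite mulr0.
    rewrite inE => /(closed_cube_sub_ball re e0)/eU[_ xp].
    rewrite (_ : delta / c * - sg * _ = delta / c *
      (dstep (- rho (row_of_tuple z) / eps - 1) / eps *
      (sg * partial j rho (row_of_tuple z)))); last by rewrite /dlayer; ring.
    rewrite mulr_ge0//; first by rewrite divr_ge0// ltW.
    rewrite mulr_ge0//; first by rewrite divr_ge0 ?dstep_ge0// ltW.
    by rewrite ltW// (lt_trans c0).
  have EB z : Omega (row_of_tuple z) -> `|E (row_of_tuple z)| <= B z.
    move=> Oz; have [zr|nzr] := pselect (ball x0 r (row_of_tuple z)).
      apply: (le_trans (Esmall _ Oz zr)); rewrite /B patchE mem_set ?mulrA//.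
      exact: ball_sub_closed_cube zr.
    by rewrite E0// normr0.
  have cE x : Omega x -> {for x, continuous E}.
    move=> Ox; have cf y : Omega y -> ball x0 e y ->
        {for y, continuous (fun x => \sum_(i < d) G i x * dlayer eps i x)}.
      move=> Oy ye; apply: continuous_sum => i; apply: continuousM.
        by have [] := CG i Oy.
      exact: cdlayer.
    have ct y : Omega y -> {for y, continuous theta} by move=> Oy; have [] := Ct j y Oy.
    have -> : E = (fun y => (\sum_(i < d) G i y * dlayer eps i y) * theta y).
      by apply/funext => y; rewrite /E mulrC.
    exact: (continuous_cut r0 re ct t0 cf Ox).
  have mO := measurable_open_tuple oO.
  have [iE leE] := le_normr_Rintegral_dominated mO (measurable_fun_open oO cE) EB B0 iB.
  have iL : integrable_over Omega (fun x => layer eps x * weak_div theta theta' x).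
    apply: (@bounded_integrable_over _ _ _ _ W) => //.
      have r20 : 0 < 2 * r by lra.
      by apply: (continuous_cut r20 r2e cw w0) => y _; exact: clayer.
    move=> x Ox; rewrite normrM (le_trans _ (HW x Ox))// -[leRHS]mul1r ler_wpM2r//.
    by rewrite ger0_norm; case/andP: (layer01 eps x).
  have -> : integral_over Omega (fun x => layer eps x * weak_div theta theta' x) =
      - integral_over Omega E.
    apply/eqP; rewrite -addr_eq0 -integral_overD//; apply/eqP; rewrite -[RHS]cut0.
    by apply: eq_integral_over => x _; rewrite cutE.
  rewrite normrN; apply: (le_trans leE).
  rewrite /B RintegralZl//; apply: (le_trans (ler_norm _)).
  rewrite normrM [`|delta / c * _|]normrM normrN sg1 mulr1 [`|delta / c|]ger0_norm; last first.
    by rewrite divr_ge0// ltW.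
  by apply: ler_wpM2l leD; rewrite divr_ge0// ltW.
have lim : integral_over Omega (fun x => layer n.+1%:R^-1 x * weak_div theta theta' x)
    @[n --> \oo] --> integral_over Omega (weak_div theta theta').
  apply: (@dominated_integral_over _ _ _ _ _ W) => //.
  - move=> n x Ox; have r20 : 0 < 2 * r by lra.
    by apply: (continuous_cut r20 r2e cw w0) => // y _; exact: clayer.
  - move=> n x Ox; rewrite normrM (le_trans _ (HW x Ox))// -[leRHS]mul1r ler_wpM2r//.
    by rewrite ger0_norm; case/andP: (layer01 n.+1%:R^-1 x).
  - move=> x Ox; have [xr|nxr] := pselect (ball x0 (2 * r) x); last first.
      rewrite w0//; under eq_fun do rewrite mulr0.
      exact: cvg_cst.
    rewrite -[X in _ --> X]mul1r; apply: cvgM; last exact: cvg_cst.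
    apply: layer_limit; apply/rhoP => //.
    by have [] := eU _ (le_ball (ltW r2e) xr).
apply/eqP; rewrite -normr_le0 leNgt; apply/negP => I0.
pose I := `|integral_over Omega (weak_div theta theta')|.
pose delta := I / 2 * c / (K + 1).
have K1 : 0 < K + 1 by rewrite ltr_wpDl.
have delta0 : 0 < delta by rewrite divr_gt0// mulr_gt0// divr_gt0.
have dK : delta / c * K < I.
  have cn0 : c != 0 by rewrite gt_eqF.
  have K1n : K + 1 != 0 by rewrite gt_eqF.
  have -> : delta / c * K = I / 2 * (K / (K + 1)).
    by rewrite /delta; field; rewrite K1n.
  apply: (@le_lt_trans _ _ (I / 2 * 1)).
    by rewrite ler_pM2l ?divr_gt0// ler_pdivrMr// mul1r lerDl.
  by rewrite mulr1 gtr_pMr// invf_lt1// ltr1n.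
have nI := cvgr_gt _ (cvg_norm lim) _ dK.
near \oo => n.
have h1 : delta / c * K < `|integral_over Omega
    (fun x => layer n.+1%:R^-1 x * weak_div theta theta' x)|.
  by near: n; exact: nI.
have h2 : `|integral_over Omega
    (fun x => layer n.+1%:R^-1 x * weak_div theta theta' x)| <= delta / c * K.
  by near: n; exact: (main _ delta0).
by have := lt_le_trans h1 h2; rewrite ltxx.
Unshelve. all: by end_near. Qed.

End Boundary.

Lemma local_divergence x0 : closure Omega x0 ->
  exists2 r, 0 < r & forall theta theta', test_function x0 r theta theta' ->
    integral_over Omega (weak_div theta theta') = 0.
Proof.
move=> cx0; have [Ox0|nOx0] := pselect (Omega x0).
  exact: (local_interior Ox0).
have bx0 : boundary Omega x0 by split => // /interior_subset.
have [U [rho defU]] := smooth bx0.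
exact: (local_boundary bx0 defU).
Qed.

(** Sum the local statements over a partition of unity [theta k] = [psi k / S]:
    the gradients of its members add up to zero. *)
Theorem integral_div_eq0 : integral_over Omega (fun x => \sum_(i < d) G' i x) = 0.
Proof.
have /choice[r Hr] : forall x0, exists r, closure Omega x0 -> 0 < r /\
    forall theta theta', test_function x0 r theta theta' ->
    integral_over Omega (weak_div theta theta') = 0.
  move=> x0; have [cx0|] := pselect (closure Omega x0); last by exists 0.
  by have [r r0 Hr] := local_divergence cx0; exists r.
pose psi x0 := cap x0 (r x0).
have /choice[psi' Cpsi] : forall x0, exists f' : 'I_d -> 'rV[R]_d -> R,
    forall i, C1_along setT i (psi x0) (f' i).
  move=> x0; have Cb i := C1_along_cap x0 (r x0) i.
  by have [f' Cf'] := choice Cb; exists f'.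
have cpsi x0 : continuous (psi x0).
  move=> x; have [i|d0] := pselect (exists i : 'I_d, True).
    by case: i => i _; have [] := Cpsi x0 i x I.
  have -> : psi x0 = cst (psi x0 0).
    apply/funext => y /=; rewrite /psi /cap !big1// => k _; exfalso; apply: d0;
    by exists k.
  exact: cst_continuous.
have := compact_closure_bounded; rewrite compact_cover.
move=> /(_ _ (closure Omega) (fun x0 => [set x | 0 < psi x0 x])).
case.
- move=> x0 _; rewrite openE => x /= px.
  by have /cvgr_gt := cpsi x0 x; exact.
- by move=> x cx; exists x => //=; apply: cap_center; have [] := Hr x cx.
move=> D0 sD0 cD0; pose D : seq 'rV[R]_d := finmap.enum_fset D0.
have sD k : k \in D -> closure Omega k by move=> /sD0; rewrite inE.
have cD x : closure Omega x -> exists2 k, k \in D & 0 < psi k x.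
  by move=> /cD0[k kD pk]; exists k.
pose S x := \sum_(k <- D) psi k x.
have S0 x : closure Omega x -> 0 < S x.
  move=> /cD[k kD pk]; rewrite /S (big_rem k)//= ltr_wpDr// sumr_ge0// => l _.
  exact: cap_ge0.
pose V := [set x | 0 < S x].
have CS i := C1_along_sum D (fun k => Cpsi k i).
have /choice[iS' CiS] : forall i, exists g', C1_along V i (fun x => (S x)^-1) g'.
  move=> i; apply: (@C1_along_inv _ _ V i S); first by move=> x /= Sx; rewrite gt_eqF.
  exact: C1_alongS (CS i).
pose theta k x := psi k x * (S x)^-1.
pose theta' k i x := psi k x * iS' i x + (S x)^-1 * psi' k i x.
have Ct k i : C1_along V i (theta k) (theta' k i).
  by apply: C1_alongM (CiS i); exact: C1_alongS (Cpsi k i).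
have OV : closure Omega `<=` V by move=> x /S0.
have Tt k : k \in D -> test_function k (r k) (theta k) (theta' k).
  move=> kD; have ck := sD k kD.
  split.
  - by move=> i; apply: C1_alongS (Ct k i) => x /subset_closure/OV.
  - move=> x Ox; have Sx := S0 _ (subset_closure Ox).
    rewrite ger0_norm; last by rewrite divr_ge0 ?cap_ge0// ltW.
    rewrite ler_pdivrMr// mul1r /S (big_rem k)//= lerDl sumr_ge0// => l _.
    exact: cap_ge0.
  - have /choice[K HK] : forall i, exists K, 0 <= K /\
        forall x, closure Omega x -> `|theta' k i x| <= K.
      move=> i; have [|K K0 HK] := @compact_within_bounded R _ (closure Omega) (theta' k i) compact_closure_bounded.
        apply: continuous_in_subspaceT => x; rewrite inE => /OV Vx.
        by have [] := Ct k i x Vx.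
      by exists K.
    exists (\sum_i K i) => i x Ox; rewrite (bigD1 i)//= ler_wpDr//.
      by apply: sumr_ge0 => l _; have [] := HK l.
    by have [_] := HK i; apply; exact: subset_closure.
  - move=> x Ox nb; rewrite /theta /psi cap_out ?mul0r//.
    by have [] := Hr k ck.
have E x : Omega x -> \sum_(i < d) G' i x =
    \sum_(k <- D) weak_div (theta k) (theta' k) x.
  move=> Ox; have cx := subset_closure Ox.
  have St y : closure Omega y -> \sum_(k <- D) theta k y = 1.
    by move=> cy; rewrite /theta -mulr_suml divff// gt_eqF// S0.
  have St' i : \sum_(k <- D) theta' k i x = 0.
    have Csum := C1_alongD (C1_along_sum D (fun k => Ct k i))
      (@C1_along_cst _ _ V i (-1)).
    have [_ dt _] := Csum x (OV x cx).
    rewrite -[LHS]addr0; apply: is_derive_near0 dt.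
    apply: filterS (open_nbhs_nbhs (conj oO Ox)) => y Oy.
    by rewrite St ?subrr//; exact: subset_closure.
  rewrite /weak_div big_split/= -mulr_suml St// mul1r exchange_big/=.
  rewrite [X in _ + X]big1 ?addr0// => i _.
  by rewrite -mulr_sumr St' mulr0.
rewrite (eq_integral_over E) integral_over_sum//.
  rewrite big_seq big1// => k kD; have ck := sD k kD.
  by have [_] := Hr k ck; apply; exact: Tt.
move=> k kD; have [K HK] := weak_div_bounded (Tt k kD).
apply: bounded_integrable_over HK => //.
by move=> x Ox; apply: (weak_div_continuous (Tt k kD)).
Qed.

End Divergence.

(** * The energy polynomial *)

Section BivariatePolynomials.
Context {R : realType}.
Implicit Types (c : nat -> R) (e h : nat -> nat).

Definition bipoly n c e h (x y : R) : R := \sum_(k < n) c k * (x ^+ e k * y ^+ h k).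

Definition bipoly_dx n c e h := bipoly n (fun k => c k * (e k)%:R) (fun k => (e k).-1) h.
Definition bipoly_dy n c e h := bipoly n (fun k => c k * (h k)%:R) e (fun k => (h k).-1).

Lemma is_derive_bipoly (V : normedModType R) n c e h (f g : V -> R) (x v : V) df dg :
  is_derive x v f df -> is_derive x v g dg ->
  is_derive x v (fun y => bipoly n c e h (f y) (g y))
    (bipoly_dx n c e h (f x) (g x) * df + bipoly_dy n c e h (f x) (g x) * dg).
Proof.
move=> Df Dg.
have Dk k : is_derive x v (fun y => c k * (f y ^+ e k * g y ^+ h k))
   (c k * (e k)%:R * (f x ^+ (e k).-1 * g x ^+ h k) * df +
    c k * (h k)%:R * (f x ^+ e k * g x ^+ (h k).-1) * dg).
  have D := is_deriveZ (c k) (is_deriveM (is_deriveX (e k) Df) (is_deriveX (h k) Dg)).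
  rewrite [X in is_derive _ _ _ X](_ : _ = c k *: (f x ^+ e k *: ((h k)%:R * g x ^+ (h k).-1 *: dg) +
     g x ^+ h k *: ((e k)%:R * f x ^+ (e k).-1 *: df))).
    by rewrite !exprfctE in D.
  by rewrite /GRing.scale/=; ring.
have D := is_derive_sum (fun i : 'I_n => Dk i).
rewrite (_ : (fun y => _) = \sum_(i < n) (fun y => c i * (f y ^+ e i * g y ^+ h i))); last first.
  by apply/funext => y; rewrite fct_sumE.
rewrite [X in is_derive _ _ _ X](_ : _ = \sum_(i < n) (c i * (e i)%:R * (f x ^+ (e i).-1 * g x ^+ h i) * df +
    c i * (h i)%:R * (f x ^+ e i * g x ^+ (h i).-1) * dg)); first exact: D.
by rewrite big_split /bipoly_dx /bipoly_dy /bipoly !mulr_suml.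
Qed.

Lemma continuous_bipoly (T : topologicalType) n c e h (f g : T -> R) x :
  {for x, continuous f} -> {for x, continuous g} ->
  {for x, continuous (fun y => bipoly n c e h (f y) (g y))}.
Proof.
move=> cf cg; apply: continuous_sum => k.
apply: continuousM; first exact: cst_continuous.
apply: continuousM.
  exact: (continuous_comp cf (@exprn_continuous R (e k) _)).
exact: (continuous_comp cg (@exprn_continuous R (h k) _)).
Qed.

Lemma C1_along_bipoly d (U : set 'rV[R]_d) i n c e h f f' g g' :
  C1_along U i f f' -> C1_along U i g g' ->
  C1_along U i (fun y => bipoly n c e h (f y) (g y))
    (fun y => bipoly_dx n c e h (f y) (g y) * f' y +
              bipoly_dy n c e h (f y) (g y) * g' y).
Proof.
move=> Cf Cg x Ux; have [cf df cf'] := Cf x Ux; have [cg dg cg'] := Cg x Ux.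
split; [exact: continuous_bipoly|exact: is_derive_bipoly|].
by apply: continuousD; apply: continuousM => //; exact: continuous_bipoly.
Qed.

End BivariatePolynomials.

Section Energy.
Context {R : realType}.
Variables (kappa : R) (n : nat).
Hypothesis kappa0 : 0 < kappa.

(** The coefficients lambda^(k^2) have the second ratios
    c_k c_(k+2) / c_(k+1)^2 = lambda^2 at their disposal, and lambda is chosen so
    large that [energy_coefSS] holds. *)
Definition energy_ratio : R := (n.+1%:R ^+ 2) * (1 + kappa) * (1 + kappa^-1).
Definition energy_coef (k : nat) : R := energy_ratio ^+ (k ^ 2).

Let c := energy_coef.
Let e k := (2 * k)%N.
Let h k := (n.+1 - k)%N.

Definition energy := bipoly n.+2 c e h.
Definition energy_v := bipoly_dx n.+2 c e h.
Definition energy_w := bipoly_dy n.+2 c e h.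
Definition energy_vv := bipoly_dx n.+2 (fun k => c k * (e k)%:R) (fun k => (e k).-1) h.
Definition energy_vw := bipoly_dy n.+2 (fun k => c k * (e k)%:R) (fun k => (e k).-1) h.
Definition energy_ww := bipoly_dy n.+2 (fun k => c k * (h k)%:R) e (fun k => (h k).-1).

Lemma energy_vwC : bipoly_dx n.+2 (fun k => c k * (h k)%:R) e (fun k => (h k).-1) = energy_vw.
Proof.
by apply/funext => x; apply/funext => y; apply: eq_bigr => k _; rewrite [c k * _ * _]mulrAC.
Qed.

Lemma energy_ratio_ge : n.+1%:R <= energy_ratio.
Proof.
have k1 : 0 < kappa^-1 by rewrite invr_gt0.
have n1 : 1 <= n.+1%:R :> R by rewrite ler1n.
rewrite /energy_ratio -mulrA expr2 -mulrA -[leLHS]mulr1 ler_wpM2l//.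
by rewrite (le_trans n1)// ler_peMr// mulr_ege1// lerDl ltW.
Qed.

Lemma energy_ratio_ge1 : 1 <= energy_ratio.
Proof. by apply: le_trans energy_ratio_ge; rewrite ler1n. Qed.

Lemma energy_coef_ge1 k : 1 <= c k.
Proof. exact: exprn_ege1 energy_ratio_ge1. Qed.

Lemma energy_coefS k : n.+1%:R * c k <= c k.+1.
Proof.
rewrite /c /energy_coef (_ : (k.+1 ^ 2 = (2 * k) + (1 + k ^ 2))%N); last by ring.
rewrite exprD exprD expr1 -[leLHS]mul1r ler_pM//.
- by rewrite mulr_ge0// exprn_ge0// (le_trans ler01 energy_ratio_ge1).
- exact: exprn_ege1 energy_ratio_ge1.
- by rewrite ler_wpM2r ?energy_ratio_ge// exprn_ge0// (le_trans ler01 energy_ratio_ge1).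
Qed.

Lemma energy_coefSS k :
  ((1 + kappa) * c k.+1 * n.+1%:R ^+ 2) ^+ 2 <= kappa * (c k.+2 * c k).
Proof.
have -> : c k.+2 * c k = c k.+1 ^+ 2 * energy_ratio ^+ 2.
  rewrite /c /energy_coef -!exprM -!exprD; congr (_ ^+ _); ring.
rewrite /energy_ratio.
have k1 : 0 < kappa^-1 by rewrite invr_gt0.
have -> : kappa * (c k.+1 ^+ 2 * (n.+1%:R ^+ 2 * (1 + kappa) * (1 + kappa^-1)) ^+ 2) =
  ((1 + kappa) * c k.+1 * n.+1%:R ^+ 2) ^+ 2 * (kappa * (1 + kappa^-1) ^+ 2) by ring.
rewrite ler_peMr ?sqr_ge0//.
have -> : kappa * (1 + kappa^-1) ^+ 2 = kappa + 2 + kappa^-1.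
  by field; rewrite gt_eqF.
by move: kappa0 => kp; lra.
Qed.

(** With q_j = x^(2j) y^(n-1-j), the coefficient of a^2 dominates
    the sum of c_(j+2) x^2 q_j, that of b^2 dominates the sum of kappa c_j q_j,
    and the mixed one is a sum of multiples of c_(j+1) x q_j; the form is thus a
    sum over j of q_j times a form in (x a, b) whose discriminant has the right
    sign by [energy_coefSS]. *)
Lemma energy_quadratic (x y a b : R) : 0 <= y ->
  0 <= (energy_vv x y - energy_w x y) * a ^+ 2 +
       (1 + kappa) * energy_vw x y * (a * b) + kappa * energy_ww x y * b ^+ 2.
Proof.
move=> y0.
have c1 := energy_coef_ge1.
have c0 k : 0 <= c k by rewrite (le_trans ler01).
pose q (j : nat) := x ^+ (2 * j) * y ^+ (n - j.+1).
have x2 k : 0 <= x ^+ (2 * k) by rewrite exprM exprn_ge0// sqr_ge0.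
have q0 j : 0 <= q j by rewrite mulr_ge0// exprn_ge0.
have hA : \sum_(j < n) c j.+2 * (x ^+ 2 * q j) <= energy_vv x y - energy_w x y.
  have -> : energy_vv x y - energy_w x y = \sum_(j < n.+1)
      (c j.+1 * (2 * j.+1)%:R * ((2 * j.+1).-1)%:R - c j * (n.+1 - j)%:R) *
      (x ^+ (2 * j) * y ^+ (n - j)).
    rewrite /energy_vv /energy_w /bipoly_dx /bipoly_dy /bipoly.
    rewrite big_ord_recl [X in _ - X]big_ord_recr /=.
    rewrite /e /h muln0 mulr0 !mul0r add0r subnn mulr0 mul0r addr0.
    rewrite -sumrB; apply: eq_bigr => j _; rewrite mulrBl /bump /= add1n subSS.
    congr (_ * (_ * _) - _ * (_ * _)); congr (_ ^+ _); have := ltn_ord j; lia.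
  apply: (@le_trans _ _ (\sum_(j < n.+1) c j.+1 * (x ^+ (2 * j) * y ^+ (n - j)))).
    rewrite big_ord_recl /=; apply: ler_wpDl.
      by apply: mulr_ge0 => //; apply: mulr_ge0 => //; exact: exprn_ge0.
    by apply: ler_sum => j _; rewrite /bump /= add1n /q mulnS exprD !mulrA.
  apply: ler_sum => j _; apply: ler_wpM2r; first by rewrite mulr_ge0// exprn_ge0.
  have h1 : c j * (n.+1 - j)%:R <= c j.+1.
    apply: le_trans (energy_coefS j); rewrite mulrC ler_wpM2r// ler_nat.
    exact: leq_subr.
  have h2 : c j.+1 * 2 <= c j.+1 * (2 * j.+1)%:R * ((2 * j.+1).-1)%:R.
    by rewrite -mulrA -natrM ler_wpM2l// ler_nat; nia.
  lra.
have hB : energy_vw x y = \sum_(j < n) c j.+1 * (2 * j.+1 * (n - j))%:R * (x * q j).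
  rewrite /energy_vw /bipoly_dy /bipoly.
  rewrite big_ord_recl big_ord_recr /=.
  rewrite /e /h muln0 mulr0 !mul0r add0r /bump /= add1n subnn mulr0 mul0r addr0.
  apply: eq_bigr => j _; rewrite /bump /= add1n subSS -[_ * _ * (n - j)%:R]mulrA -natrM.
  by congr (_ * _); rewrite /q mulrA -exprS; congr (_ ^+ _ * _ ^+ _); have := ltn_ord j; lia.
have hD : \sum_(j < n) c j * q j <= energy_ww x y.
  rewrite /energy_ww /bipoly_dy /bipoly.
  rewrite big_ord_recr big_ord_recr /=.
  rewrite /h subnn subSn// subnn /= !mulr0 !mul0r !addr0.
  apply: ler_sum => j _; rewrite /q /e -!mulrA; apply: ler_wpM2l => //.
  rewrite mulrA -natrM.
  have -> : (n.+1 - j).-1.-1 = (n - j.+1)%N by have := ltn_ord j; lia.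
  apply: ler_peMl; first exact: q0.
  by rewrite ler1n; have := ltn_ord j; nia.
apply: (@le_trans _ _ (\sum_(j < n) q j * (c j.+2 * (x * a) ^+ 2 +
   (1 + kappa) * c j.+1 * (2 * j.+1 * (n - j))%:R * ((x * a) * b) +
   kappa * c j * b ^+ 2))).
  apply: sumr_ge0 => j _; rewrite mulr_ge0//.
  set P := x * a; set N := (2 * j.+1 * (n - j))%:R.
  have cj : 0 < c j by exact: lt_le_trans (c1 j).
  have cj2 : 0 < c j.+2 by exact: lt_le_trans (c1 j.+2).
  have NN : N <= 2 * n.+1%:R ^+ 2.
    rewrite /N -natrX -natrM ler_nat -mulnA leq_mul2l /= -mulnn leq_mul//.
      exact: ltn_trans (ltn_ord j) _.
    exact: leq_trans (leq_subr _ _) _.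
  have disc : ((1 + kappa) * c j.+1 * N) ^+ 2 <= 4 * (kappa * (c j.+2 * c j)).
    apply: (@le_trans _ _ (4 * ((1 + kappa) * c j.+1 * n.+1%:R ^+ 2) ^+ 2)).
      rewrite [leRHS](_ : _ = ((1 + kappa) * c j.+1 * (2 * n.+1%:R ^+ 2)) ^+ 2); last by ring.
      rewrite ler_sqr ?nnegrE ?mulr_ge0//; do 1? by rewrite addr_ge0// ltW.
      by apply: ler_wpM2l => //; rewrite mulr_ge0// addr_ge0// ltW.
    by rewrite ler_wpM2l// energy_coefSS.
  set Bj := (1 + kappa) * c j.+1 * N in disc *.
  set Aj := c j.+2 in cj2 disc *.
  have -> : Aj * P ^+ 2 + Bj * (P * b) + kappa * c j * b ^+ 2 =
     ((2 * Aj * P + Bj * b) ^+ 2 + (4 * (kappa * (Aj * c j)) - Bj ^+ 2) * b ^+ 2) / (4 * Aj).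
    by field; rewrite gt_eqF.
  rewrite divr_ge0//; last by rewrite mulr_ge0// ltW.
  by rewrite addr_ge0 ?sqr_ge0// mulr_ge0 ?sqr_ge0// subr_ge0.
rewrite hB [X in X <= _](_ : _ = (\sum_(j < n) c j.+2 * (x ^+ 2 * q j)) * a ^+ 2 +
  (1 + kappa) * (\sum_(j < n) c j.+1 * (2 * j.+1 * (n - j))%:R * (x * q j)) * (a * b) +
  kappa * (\sum_(j < n) c j * q j) * b ^+ 2).
  rewrite lerD// ?lerD2r//.
    by apply: ler_wpM2r => //; exact: sqr_ge0.
  by apply: ler_wpM2r; [exact: sqr_ge0|apply: ler_wpM2l => //; exact: ltW].
rewrite !mulr_sumr !mulr_suml -!big_split /=; apply: eq_bigr => j _.
by ring.
Qed.

Lemma energy_ge (x y : R) : 0 <= y -> x ^+ (2 * n.+1) + y ^+ n.+1 <= energy x y.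
Proof.
move=> y0; have c1 := energy_coef_ge1.
have x2 k : 0 <= x ^+ (2 * k) by rewrite exprM exprn_ge0// sqr_ge0.
rewrite /energy /bipoly big_ord_recl big_ord_recr /= [leLHS]addrC lerD//.
  rewrite /e /h muln0 subn0 expr0 mul1r ler_peMl// exprn_ge0//.
rewrite /bump /= add1n /e /h subnn expr0 mulr1.
apply: ler_wpDl; last by rewrite ler_peMl.
apply: sumr_ge0 => k _; apply: mulr_ge0; first exact: le_trans ler01 (c1 _).
by apply: mulr_ge0; [exact: x2|exact: exprn_ge0].
Qed.

Definition energy_const : R := \sum_(k < n.+2) c k.

Lemma energy_const_ge1 : 1 <= energy_const.
Proof.
rewrite /energy_const big_ord_recl ler_wpDr// ?energy_coef_ge1// sumr_ge0// => k _.
exact: le_trans ler01 (energy_coef_ge1 _).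
Qed.

Lemma energy_le (x y : R) : 0 <= y ->
  energy x y <= energy_const * (x ^+ (2 * n.+1) + y ^+ n.+1).
Proof.
move=> y0; rewrite /energy /bipoly /energy_const mulr_suml; apply: ler_sum => k _.
apply: ler_wpM2l; first exact: le_trans ler01 (energy_coef_ge1 _).
rewrite /e /h !exprM; have kn : (k <= n.+1)%N by rewrite -ltnS.
have [xy|yx] := leP (x ^+ 2) y.
  apply: (@le_trans _ _ (y ^+ n.+1)); last by rewrite ler_wpDl// exprn_ge0// sqr_ge0.
  rewrite -[in leRHS](subnKC kn) exprD; apply: ler_wpM2r; first exact: exprn_ge0.
  by rewrite lerXn2r ?nnegrE ?sqr_ge0.
apply: (@le_trans _ _ ((x ^+ 2) ^+ n.+1)); last by rewrite ler_wpDr// exprn_ge0.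
rewrite -[in leRHS](subnKC kn) exprD; apply: ler_wpM2l; first by rewrite exprn_ge0 ?sqr_ge0.
by rewrite lerXn2r ?nnegrE ?sqr_ge0// ltW.
Qed.

End Energy.

(** * Dissipation of the energy at a fixed time *)

Section WithinContinuity.

Lemma continuous_within_comp (S T U : topologicalType) (A : set S) (B : set T)
    (h : S -> T) (g : T -> U) :
  continuous h -> (forall x, A x -> B (h x)) -> {within B, continuous g} ->
  {within A, continuous (g \o h)}.
Proof.
move=> ch AB /subspace_continuousP cg; apply/subspace_continuousP => x Ax.
move=> W /= gW; have BW : nbhs (h x) [set y | B y -> W (g y)].
  exact: (cg _ (AB _ Ax) W gW).
have hBW : nbhs x (h @^-1` [set y | B y -> W (g y)]) by exact: (ch x _ BW).
change (nbhs x [set y | A y -> W (g (h y))]).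
by apply: (filterS _ hBW) => y /= h1 Ay; apply: h1; exact: AB.
Qed.

Lemma within_continuous_coord {R : realType} (T : topologicalType) (A : set T) d (f : T -> 'rV[R]_d) i :
  {within A, continuous f} -> {within A, continuous (fun x => f x 0 i)}.
Proof.
move=> cf x; apply: (@continuous_comp (subspace A) _ _ f (fun y : 'rV[R]_d => y 0 i)).
  exact: cf.
exact: coord_continuous.
Qed.

Lemma within_continuous_open (T U : topologicalType) (A O : set T) (f : T -> U) :
  open O -> O `<=` A -> {within A, continuous f} ->
  forall x, O x -> {for x, continuous f}.
Proof.
move=> oO OA cf x Ox.
have H : {within O, continuous f} by apply: (continuous_subspaceW OA).
have {}H : {in O, continuous f} by rewrite -continuous_open_subspace.
exact: (H x (mem_set Ox)).
Qed.

End WithinContinuity.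

Section Dissipation.
Context {R : realType} {d : nat}.
Implicit Types (x y : 'rV[R]_d) (i : 'I_d).
Variables (Omega : set 'rV[R]_d) (eta kap : R -> R) (kappa : R) (n : nat).
Variables (v w vt wt : 'rV[R]_d -> R) (Dv Dw : 'rV[R]_d -> 'rV[R]_d).
Let Fv x := eta (w x) *: Dv x.
Let Fw x := kap (w x) *: Dw x.
Hypothesis smoothO : smooth_bounded_domain Omega.
Hypothesis kappa0 : 0 < kappa.
Hypothesis eta0 : forall s, 0 <= s -> 0 <= eta s.
Hypothesis kapE : forall s, 0 <= s -> kap s = kappa * eta s.
Hypothesis w0 : forall x, closure Omega x -> 0 <= w x.
Hypothesis cv : {within closure Omega, continuous v}.
Hypothesis cw : {within closure Omega, continuous w}.
Hypothesis cvt : {within closure Omega, continuous vt}.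
Hypothesis cwt : {within closure Omega, continuous wt}.
Hypothesis cDv : {within closure Omega, continuous Dv}.
Hypothesis cDw : {within closure Omega, continuous Dw}.
Hypothesis dv : forall x i, Omega x -> is_derive x (basis_vec i) v (Dv x 0 i).
Hypothesis dw : forall x i, Omega x -> is_derive x (basis_vec i) w (Dw x 0 i).
Hypothesis CFv : classical_flux Omega Fv.
Hypothesis CFw : classical_flux Omega Fw.
Hypothesis eq_v : forall x, Omega x -> vt x = div Fv x.
Hypothesis eq_w : forall x, Omega x ->
  wt x = div Fw x + eta (w x) * dotp (Dv x) (Dv x).
Hypothesis bc : forall x N, boundary Omega x -> outer_unit_normal Omega x N ->
  dotp (Fv x) N = 0 /\ dotp (Fw x) N = 0.

Local Notation Ev x := (energy_v kappa n (v x) (w x)).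
Local Notation Ew x := (energy_w kappa n (v x) (w x)).
Local Notation Evv x := (energy_vv kappa n (v x) (w x)).
Local Notation Evw x := (energy_vw kappa n (v x) (w x)).
Local Notation Eww x := (energy_ww kappa n (v x) (w x)).

Let oO : open Omega. Proof. by case: smoothO. Qed.
Let bO : bounded_set Omega. Proof. by case: smoothO. Qed.

Let C1_of (f : 'rV[R]_d -> R) (Df : 'rV[R]_d -> 'rV[R]_d) i :
  {within closure Omega, continuous f} -> {within closure Omega, continuous Df} ->
  (forall x i, Omega x -> is_derive x (basis_vec i) f (Df x 0 i)) ->
  C1_along Omega i f (fun x => Df x 0 i).
Proof.
move=> cf cDf df x Ox; have OO := @subset_closure _ Omega.
split; [exact: (within_continuous_open oO OO cf)|exact: df|].
have cDi := within_continuous_coord (i := i) cDf.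
exact: (within_continuous_open oO OO cDi Ox).
Qed.

Let C1_flux (F : 'rV[R]_d -> 'rV[R]_d) i : classical_flux Omega F ->
  C1_along Omega i (fun x => F x 0 i) (partial i (fun x => F x 0 i)).
Proof.
move=> [_ /(_ i)[cF /(_ i)[dF [cF' _]]]] x Ox.
by split; [exact: cF|exact/derivableP/dF|exact: cF'].
Qed.

(* the flux of the energy and the derivative of its i-th component in direction i *)
Let G i x := Ev x * Fv x 0 i + Ew x * Fw x 0 i.
Let G' i x := (Ev x * partial i (fun y => Fv y 0 i) x +
    Fv x 0 i * (Evv x * Dv x 0 i + Evw x * Dw x 0 i)) +
  (Ew x * partial i (fun y => Fw y 0 i) x +
    Fw x 0 i * (Evw x * Dv x 0 i + Eww x * Dw x 0 i)).

Let CG i : C1_along Omega i (G i) (G' i).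
Proof.
have Cv := C1_of i cv cDv dv; have Cw := C1_of i cw cDw dw.
apply: C1_alongD; apply: C1_alongM (C1_flux i _) => //.
  exact: C1_along_bipoly.
rewrite -(energy_vwC kappa n); exact: C1_along_bipoly.
Qed.

Let cbip k c e h : {within closure Omega, continuous (fun x => bipoly k c e h (v x) (w x))}.
Proof. by move=> x; apply: continuous_bipoly; [exact: cv|exact: cw]. Qed.

Let cG i : {within closure Omega, continuous (G i)}.
Proof.
have [cFv _] := CFv; have [cFw _] := CFw.
move=> x; apply: cvgD; apply: cvgM; try exact: cbip.
  exact: (within_continuous_coord (i := i) cFv).
exact: (within_continuous_coord (i := i) cFw).
Qed.

Let normal x0 U rho : boundary Omega x0 -> defining_function Omega x0 U rho ->
  \sum_(i < d) G i x0 * partial i rho x0 = 0.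
Proof.
move=> bx0 defU; have [_ Ux0 _ grho _] := defU.
have := bc bx0 (ex_intro _ U (ex_intro _ rho (conj defU erefl))).
set N := Num.sqrt _.
have N0 : N^-1 != 0.
  rewrite invr_eq0 /N sqrtr_eq0 -ltNge lt_neqAle eq_sym sumr_ge0 ?andbT; last first.
    by move=> i _; rewrite -expr2 sqr_ge0.
  apply: contra (grho _ Ux0); rewrite /dotp psumr_eq0; last first.
    by move=> i _; rewrite -expr2 sqr_ge0.
  move=> /allP g0; apply/eqP/rowP => i; rewrite [RHS]mxE; apply/eqP.
  by have := g0 i (mem_index_enum i); rewrite mulf_eq0 orbb.
have dotZ a : dotp a (N^-1 *: grad rho x0) = N^-1 * \sum_(i < d) a 0 i * partial i rho x0.
  rewrite /dotp mulr_sumr; apply: eq_bigr => i _; rewrite !mxE; ring.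
rewrite !dotZ => -[/eqP + /eqP]; rewrite !mulf_eq0 (negPf N0) /= => /eqP zv /eqP zw.
rewrite (eq_bigr (fun i => Ev x0 * (Fv x0 0 i * partial i rho x0) +
   Ew x0 * (Fw x0 0 i * partial i rho x0))); last by move=> i _; rewrite /G; ring.
by rewrite big_split/= -!mulr_sumr zv zw !mulr0 addr0.
Qed.

(* The divergence of G through quantities that are continuous up to the boundary:
   the divergences of the two fluxes are eliminated by the equations. *)
Let H x := Ev x * vt x + Ew x * (wt x - \sum_(i < d) Fv x 0 i * Dv x 0 i) +
  \sum_(i < d) (Fv x 0 i * (Evv x * Dv x 0 i + Evw x * Dw x 0 i) +
    Fw x 0 i * (Evw x * Dv x 0 i + Eww x * Dw x 0 i)).

Let divG x : Omega x -> \sum_(i < d) G' i x = H x.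
Proof.
move=> Ox; rewrite /H eq_v// eq_w//.
have -> : eta (w x) * dotp (Dv x) (Dv x) = \sum_(i < d) Fv x 0 i * Dv x 0 i.
  by rewrite /dotp mulr_sumr; apply: eq_bigr => i _; rewrite !mxE; ring.
rewrite addrK /div !mulr_sumr -!big_split/=; apply: eq_bigr => i _.
by rewrite /G'; ring.
Qed.

Let cH : {within closure Omega, continuous H}.
Proof.
have [cFv _] := CFv; have [cFw _] := CFw.
have kFv i := within_continuous_coord (i := i) cFv.
have kFw i := within_continuous_coord (i := i) cFw.
have kDv i := within_continuous_coord (i := i) cDv.
have kDw i := within_continuous_coord (i := i) cDw.
move=> x; apply: cvgD; first apply: cvgD.
- by apply: cvgM; [exact: cbip|exact: cvt].
- apply: cvgM; first exact: cbip.
  apply: cvgB; first exact: cwt.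
  apply: (@continuous_sum R (subspace (closure Omega))) => i.
  by apply: cvgM; [exact: kFv|exact: kDv].
- apply: (@continuous_sum R (subspace (closure Omega))) => i.
  apply: cvgD; apply: cvgM; [exact: kFv| |exact: kFw|].
    by apply: cvgD; apply: cvgM; [exact: cbip|exact: kDv|exact: cbip|exact: kDw].
  by apply: cvgD; apply: cvgM; [exact: cbip|exact: kDv|exact: cbip|exact: kDw].
Qed.

(** The integrand differs from the divergence of the energy flux by eta(w) times
    a sum of values of the nonnegative form [energy_quadratic]. *)
Lemma energy_dissipation :
  integral_over Omega (fun x => Ev x * vt x + Ew x * wt x) <= 0.
Proof.
have OO := @subset_closure _ Omega.
have cO := compact_closure_bounded bO.
have [M _ HM] := compact_within_bounded cO cH.
have HG : forall x, Omega x -> `|\sum_(i < d) G' i x| <= M.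
  by move=> x Ox; rewrite divG// HM//; exact: OO.
have zero : integral_over Omega H = 0.
  rewrite -(eq_integral_over divG).
  by apply: (integral_div_eq0 oO bO CG cG HG normal); case: smoothO.
rewrite -zero; pose f x := Ev x * vt x + Ew x * wt x.
have cf : {within closure Omega, continuous f}.
  by move=> x; apply: cvgD; apply: cvgM; [exact: cbip|exact: cvt|exact: cbip|exact: cwt].
have [M' _ HM'] := compact_within_bounded cO cf.
apply: le_Rintegral.
- exact: measurable_open_tuple.
- apply: (@bounded_integrable_over _ _ _ f M') => // x Ox.
    exact: (within_continuous_open oO OO cf).
  by apply: HM'; exact: OO.
- apply: (@bounded_integrable_over _ _ _ H M) => // x Ox.
    exact: (within_continuous_open oO OO cH).
  by apply: HM; exact: OO.
move=> z Oz; set x := row_of_tuple z; have cx : closure Omega x by exact: OO.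
have ew : 0 <= eta (w x) by apply/eta0/w0.
have key (A B C D : R) : eta (w x) * (\sum_(i < d)
     ((A - D) * Dv x 0 i ^+ 2 + (1 + kappa) * B * (Dv x 0 i * Dw x 0 i) +
      kappa * C * Dw x 0 i ^+ 2)) =
    \sum_(i < d) (Fv x 0 i * (A * Dv x 0 i + B * Dw x 0 i) +
      Fw x 0 i * (B * Dv x 0 i + C * Dw x 0 i)) -
    D * \sum_(i < d) Fv x 0 i * Dv x 0 i.
  rewrite !mulr_sumr -sumrB; apply: eq_bigr => i _.
  by rewrite !mxE kapE; [ring|exact: w0].
have -> : H x = Ev x * vt x + Ew x * wt x + eta (w x) * (\sum_(i < d)
   ((Evv x - Ew x) * Dv x 0 i ^+ 2 + (1 + kappa) * Evw x * (Dv x 0 i * Dw x 0 i) +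
    kappa * Eww x * Dw x 0 i ^+ 2)).
  by rewrite key /H; ring.
rewrite lerDl mulr_ge0// sumr_ge0// => i _.
by apply: energy_quadratic => //; exact: w0.
Qed.

End Dissipation.

(** * Time derivatives and Lebesgue norms *)

Section Evolution.
Context {R : realType}.

(** At interior times the one-sidedness of the derivative disappears. *)
Lemma is_derive_time (T : R) (g : R -> R) t l : 0 < t < T ->
  is_time_derivative T g t l -> is_derive t 1 g l.
Proof.
move=> /andP[t0 tT] dg.
suff cg : h^-1 *: (g (h *: 1 + t) - g t) @[h --> 0^'] --> l.
  by split; [apply/cvg_ex; exists l|exact/cvg_lim].
apply/cvgrPdist_lt => e e0.
have H : nbhs t [set s | s != t -> `[0, T]%classic s ->
    `|l - (s - t)^-1 * (g s - g t)| < e].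
  have dg' : (s - t)^-1 * (g s - g t) @[s --> within `[0, T] t^'] --> l := dg.
  move/cvgrPdist_lt: dg' => /(_ e e0) K.
  exact: (filterS _ K).
have I : nbhs t [set s | s \in `]0, T[ ].
  by apply: near_in_itvoo; rewrite in_itv/= t0.
have sh : (fun h : R => h + t) @ (0 : R) --> t.
  rewrite -[X in _ --> X]add0r; apply: cvgD; [exact: cvg_id|exact: cvg_cst].
have HI : nbhs (0 : R) [set h | (h + t != t -> `[0, T]%classic (h + t) ->
    `|l - (h + t - t)^-1 * (g (h + t) - g t)| < e) /\ h + t \in `]0, T[ ].
  exact: (@filterI _ (nbhs (0 : R)) _ _ _ (sh _ H) (sh _ I)).
apply: (@filterS _ (nbhs (0 : R)) _ _ _ _ HI) => h [h1 h2] h0.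
move: h1; rewrite addrK [h *: 1]mulr1; apply.
  by rewrite -subr_eq0 addrK.
by move: h2; rewrite in_itv/= => /andP[h3 h4]; rewrite /= in_itv/= !ltW.
Qed.

End Evolution.

Section Norms.
Context {R : realType} {d : nat}.
Implicit Types (Omega : set 'rV[R]_d) (f : 'rV[R]_d -> R).

Lemma Lp_normE Omega q f : (0 < q)%N ->
  measurable (@row_of_tuple R d @^-1` Omega) ->
  integrable_over Omega (fun x => `|f x| ^+ q) ->
  Lp_norm Omega q f =
  ((integral_over Omega (fun x => `|f x| ^+ q)) `^ q%:R^-1)%:E.
Proof.
move=> q0 mO iF; rewrite /Lp_norm unlock -poweR_EFin; congr (_ `^ _)%E.
rewrite /integral_over /Rintegral fineK; last exact: integrable_fin_num iF.
rewrite [RHS]integral_mkcond; apply: eq_integral => z _.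
rewrite /= !patchE /=; have [Oz|Oz] := pselect (Omega (row_of_tuple z)).
  by rewrite !mem_set//= powR_mulrn.
by rewrite !memNset// normr0 powR0// pnatr_eq0 -lt0n.
Qed.

Lemma eq_Lp_norm Omega q f g : (forall x, Omega x -> f x = g x) ->
  Lp_norm Omega q f = Lp_norm Omega q g.
Proof.
move=> fg; rewrite /Lp_norm; apply: eq_Lnorm => z; congr (_%:E).
by rewrite !patchE; case: ifPn => //; rewrite inE => /fg.
Qed.

(** Passage to p-th roots, where r = 1/p: both A and B are at most
    2 C max(a, b). *)
Lemma powR_le_sum (r A B C a b : R) : 0 <= r -> 0 <= A -> 0 <= B -> 0 <= C ->
  0 <= a -> 0 <= b -> A + B <= C * (a + b) ->
  A `^ r + B `^ r <= 2 * (C *+ 2) `^ r * (a `^ r + b `^ r).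
Proof.
move=> r0 A0 B0 C0 a0 b0 AB.
have C20 : 0 <= C *+ 2 by rewrite mulrn_wge0.
have key X : 0 <= X -> X <= A + B -> X `^ r <= (C *+ 2) `^ r * (a `^ r + b `^ r).
  move=> X0 XAB; have [ab|/ltW ba] := leP a b.
    apply: (@le_trans _ _ ((C *+ 2 * b) `^ r)).
      apply: ge0_ler_powR; rewrite ?nnegrE ?mulr_ge0//.
      by apply: (le_trans XAB); apply: (le_trans AB); nra.
    by rewrite powRM// ler_wpM2l ?powR_ge0// lerDr powR_ge0.
  apply: (@le_trans _ _ ((C *+ 2 * a) `^ r)).
    apply: ge0_ler_powR; rewrite ?nnegrE ?mulr_ge0//.
    by apply: (le_trans XAB); apply: (le_trans AB); nra.
  by rewrite powRM// ler_wpM2l ?powR_ge0// lerDl powR_ge0.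
rewrite -mulrA mulrDl mul1r; apply: lerD; apply: key => //; lra.
Qed.

End Norms.

(** * Decay of the energy *)

Section EnergyDecay.
Context {R : realType} {d : nat}.
Variables (Omega : set 'rV[R]_d) (T kappa0 : R) (eta kappa : R -> R) (n : nat).
Variables (v w : R -> 'rV[R]_d -> R).
Hypothesis smoothO : smooth_bounded_domain Omega.
Hypothesis kappa00 : 0 < kappa0.
Hypothesis T0 : 0 < T.
Hypothesis eta0 : forall s, 0 <= s -> 0 <= eta s.
Hypothesis kappaE : forall s, 0 <= s -> kappa s = kappa0 * eta s.
Hypothesis sol : smooth_solution Omega T eta kappa v w.
Hypothesis w0 : forall t x, 0 <= t <= T -> closure Omega x -> 0 <= w t x.

Let f t x := energy kappa0 n (v t x) (w t x).

Let oO : open Omega. Proof. by case: smoothO. Qed.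
Let bO : bounded_set Omega. Proof. by case: smoothO. Qed.
Let OO : Omega `<=` closure Omega := @subset_closure _ Omega.

Lemma continuous_up_to_boundary_space (V : topologicalType)
    (u : R -> 'rV[R]_d -> V) t : 0 <= t <= T ->
  continuous_up_to_boundary Omega T u -> {within closure Omega, continuous (u t)}.
Proof.
move=> tT cu.
have := @continuous_within_comp 'rV[R]_d (R * 'rV[R]_d)%type V (closure Omega)
  (closed_cylinder Omega T) (fun x => (t, x)) (fun z => u z.1 z.2).
apply => //.
  move=> x P [[A B] /= [tA xB] AB]; apply: (@filterS _ (nbhs x) _ _ _ _ xB) => y By.
  by apply: AB; split => //; exact: nbhs_singleton tA.
Qed.

Lemma continuous_up_to_boundary_time (V : topologicalType)
    (u : R -> 'rV[R]_d -> V) x : closure Omega x ->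
  continuous_up_to_boundary Omega T u -> {within `[0, T], continuous (u ^~ x)}.
Proof.
move=> cx cu.
have := @continuous_within_comp R (R * 'rV[R]_d)%type V `[0, T]%classic
  (closed_cylinder Omega T) (fun t => (t, x)) (fun z => u z.1 z.2).
apply => //.
move=> t P [[A B] /= [tA xB] AB]; apply: (@filterS _ (nbhs t) _ _ _ _ tA) => y Ay.
by apply: AB; split => //; exact: nbhs_singleton xB.
Qed.

Lemma compact_closed_cylinder : compact (closed_cylinder Omega T).
Proof.
apply: compact_setX; first exact: segment_compact.
exact: compact_closure_bounded.
Qed.

(** The equations hold for t > 0 only and the time derivative is two-sided only in
    the open interval; the end points are reached by Lipschitz continuity. *)
Lemma energy_nonincreasing t : 0 <= t <= T ->
  integral_over Omega (f t) <= integral_over Omega (f 0).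
Proof.
have [vt [Dv [D2v [wt [Dw [D2w]]]]]] := sol.
move=> [Cv Cw flux eqs bc] tT.
have mO := measurable_open_tuple oO.
pose ft t x := energy_v kappa0 n (v t x) (w t x) * vt t x +
  energy_w kappa0 n (v t x) (w t x) * wt t x.
have cbip k c e h : continuous_up_to_boundary Omega T
    (fun t x => bipoly k c e h (v t x) (w t x)).
  move=> z; apply: (@continuous_bipoly R (subspace _)).
    exact: (C12_cont Cv).
  exact: (C12_cont Cw).
have cft : continuous_up_to_boundary Omega T ft.
  move=> z; apply: cvgD; apply: cvgM; try exact: cbip.
    exact: (C12_cont_dt Cv).
  exact: (C12_cont_dt Cw).
have [M _ HM] := compact_within_bounded compact_closed_cylinder cft.
have [M0 _ HM0] := compact_within_bounded compact_closed_cylinder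
  (cbip n.+2 (energy_coef kappa0 n) (fun k => 2 * k)%N (fun k => n.+1 - k)%N).
have cyl s x : 0 <= s <= T -> Omega x -> closed_cylinder Omega T (s, x).
  by move=> sT Ox; split; rewrite /= ?in_itv//; exact: OO.
have If s : 0 <= s <= T -> integrable_over Omega (f s).
  move=> sT; apply: (@bounded_integrable_over _ _ _ _ M0) => //.
    apply: (within_continuous_open oO OO).
    exact: (continuous_up_to_boundary_space sT (cbip _ _ _ _)).
  by move=> x Ox; exact: (HM0 (s, x) (cyl _ _ sT Ox)).
have df s x : 0 < s < T -> Omega x -> is_derive s 1 (f ^~ x) (ft s x).
  move=> s0T Ox; have sT : 0 <= s <= T by case/andP: s0T => /ltW -> /ltW ->.
  apply: is_derive_bipoly; apply: (is_derive_time s0T).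
    exact: (C12_dt Cv).
  exact: (C12_dt Cw).
have diss s : 0 < s < T -> integral_over Omega (ft s) <= 0.
  move=> s0T; have sT : 0 <= s <= T by case/andP: s0T => /ltW -> /ltW ->.
  have s0T' : 0 < s <= T by case/andP: s0T => -> /ltW ->.
  have [Fv Fw] := flux s s0T'.
  apply: (@energy_dissipation R d Omega eta kappa kappa0 n (v s) (w s) (vt s)
    (wt s) (Dv s) (Dw s)) => //.
  - by move=> x; exact: w0.
  - exact: continuous_up_to_boundary_space sT (C12_cont Cv).
  - exact: continuous_up_to_boundary_space sT (C12_cont Cw).
  - exact: continuous_up_to_boundary_space sT (C12_cont_dt Cv).
  - exact: continuous_up_to_boundary_space sT (C12_cont_dt Cw).
  - exact: continuous_up_to_boundary_space sT (C12_cont_grad Cv).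
  - exact: continuous_up_to_boundary_space sT (C12_cont_grad Cw).
  - by move=> x i Ox; exact: (C12_grad Cv i sT Ox).
  - by move=> x i Ox; exact: (C12_grad Cw i sT Ox).
  - by move=> x Ox; have [] := eqs s x s0T' Ox.
  - by move=> x Ox; have [] := eqs s x s0T' Ox.
  - by move=> x N bx nN; exact: bc bx nN.
pose F s := integral_over Omega (f s).
have lip s s' : 0 <= s <= T -> 0 <= s' <= T ->
    `|F s - F s'| <= `|M| * fine (lebesgue_tuple d (@row_of_tuple R d @^-1` Omega)) * `|s - s'|.
  wlog ss' : s s' / s <= s'.
    move=> H sT s'T; have [ss'|/ltW ss'] := leP s s'; first exact: H.
    by rewrite distrC [`|s - s'|]distrC; exact: H.
  move=> sT s'T; rewrite /F /integral_over -RintegralB//; last 2 first.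
  - exact: If.
  - exact: If.
  have iD : (lebesgue_tuple d).-integrable (@row_of_tuple R d @^-1` Omega)
      (EFin \o (fun z => f s (row_of_tuple z) - f s' (row_of_tuple z))).
    exact: (integrableB mO (If s sT) (If s' s'T)).
  apply: (le_trans (le_normr_Rintegral mO iD)).
  rewrite mulrAC -Rintegral_cst//; apply: le_Rintegral => //.
  - exact: integrable_abse iD.
  - apply: measurable_bounded_integrable => //; first exact: finite_measure_bounded.
    exact: bounded_cst.
  move=> z Oz; set x := row_of_tuple z; have cx := OO Oz.
  have sub : `[s, s']%classic `<=` `[0, T]%classic.
    by apply: subset_itv; rewrite bnd_simp; [case/andP: sT|case/andP: s'T].
  have [||c cs E] := @MVT_segment R (f ^~ x) (ft ^~ x) s s' ss'.
  - move=> u us; apply: df => //; move: us; rewrite in_itv/= => /andP[su us'].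
    by case/andP: sT => s0 _; case/andP: s'T => _ s'T; rewrite (le_lt_trans s0 su) (lt_le_trans us' s'T).
  - apply: (continuous_subspaceW sub).
    exact: (continuous_up_to_boundary_time cx (cbip _ _ _ _)).
  rewrite distrC; move: E => /= ->; rewrite normrM distrC ler_wpM2r//.
  have cT : 0 <= c <= T by have := sub c cs; rewrite /= in_itv.
  by apply: (le_trans (HM (c, x) (cyl _ _ cT Oz))); exact: ler_norm.
have cF : {within `[0, T], continuous F}.
  apply/subspace_continuousP => s /=; rewrite in_itv/= => sT.
  apply/cvgrPdist_lt => e e0.
  pose K := `|M| * fine (lebesgue_tuple d (@row_of_tuple R d @^-1` Omega)).
  have K0 : 0 <= K by rewrite mulr_ge0// fine_ge0.
  have K1 : 0 < K + 1 by rewrite ltr_wpDl.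
  change (nbhs s [set u | `[0, T]%classic u -> `|F s - F u| < e]).
  have ek : 0 < e / (K + 1) by rewrite divr_gt0.
  have nb : nbhs s (ball s (e / (K + 1))) by exact: nbhsx_ballx.
  apply: (@filterS _ (nbhs s) _ _ _ _ nb) => u /= su.
  rewrite in_itv/= => uT; apply: (le_lt_trans (lip _ _ sT uT)); rewrite -/K.
  apply: (@le_lt_trans _ _ ((K + 1) * `|s - u|)); first by rewrite ler_wpM2r// lerDl.
  by rewrite mulrC -ltr_pdivlMr.
have dF s : s \in `]0, T[ -> derivable F s 1 /\ derive1 F s <= 0.
  move=> s0T.
  have io : forall u, `]0, T[%classic u -> 0 < u < T by move=> u; rewrite /= in_itv.
  have ic u : 0 < u < T -> 0 <= u <= T by case/andP => /ltW -> /ltW ->.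
  have intf u : `]0, T[%classic u -> (lebesgue_tuple d).-integrable
      (@row_of_tuple R d @^-1` Omega) (EFin \o (fun z => f u (row_of_tuple z))).
    by move=> /io/ic; exact: If.
  have derf u z : `]0, T[%classic u -> Omega (row_of_tuple z) ->
      derivable (fun r => f r (row_of_tuple z)) u 1.
    by move=> /io uT Oz; have [] := df u _ uT Oz.
  have dE u z : 0 < u < T -> Omega (row_of_tuple z) ->
      partial1of2 (fun r z => f r (row_of_tuple z)) u z = ft u (row_of_tuple z).
    by move=> uT Oz; rewrite partial1of2E; have [_ ->] := df u _ uT Oz.
  have iM : (lebesgue_tuple d).-integrable (@row_of_tuple R d @^-1` Omega)
      (EFin \o (cst `|M|)).
    apply: measurable_bounded_integrable => //; first exact: finite_measure_bounded.
    exact: bounded_cst.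
  have ub u z : `]0, T[%classic u -> Omega (row_of_tuple z) ->
      `|partial1of2 (fun r z => f r (row_of_tuple z)) u z| <= cst `|M| z.
    move=> /io uT Oz; rewrite dE//.
    by apply: (le_trans (HM (u, _) (cyl _ _ (ic _ uT) Oz))); exact: ler_norm.
  have M0' (z : d.-tuple (measurableTypeR R)) : 0 <= cst `|M| z by [].
  split; first exact: (derivable_under_integral mO s0T intf derf M0' iM ub).
  rewrite (differentiation_under_integral mO s0T intf derf M0' iM ub).
  have s0T' : 0 < s < T by apply: io.
  apply: le_trans (diss s s0T').
  rewrite le_eqVlt; apply/orP; left; apply/eqP; apply: eq_Rintegral => z.
  by rewrite inE => Oz; exact: dE.
have := @ler0_derive1_le_cc R F 0 T (fun s sI => (dF s sI).1) (fun s sI => (dF s sI).2) cF.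
case/andP: (tT) => t0 tT'; apply => //; rewrite in_itv/= ?lexx ?ltW//.
Qed.

End EnergyDecay.

(** * The a priori estimate *)

Theorem proposition5p3 (R : realType) (kappa0 : R) (p : nat) :
  0 < kappa0 -> (1 <= p)%N ->
  exists C : R,
  forall (d : nat) (Omega : set 'rV[R]_d) (T : R) (eta kappa : R -> R)
    (v0 w0 : 'rV[R]_d -> R) (v w : R -> 'rV[R]_d -> R),
  (0 < d)%N -> smooth_bounded_domain Omega -> 0 < T ->
  (forall s, 0 <= s -> 0 <= eta s) ->
  (forall s, 0 <= s -> kappa s = kappa0 * eta s) ->
  smooth_solution Omega T eta kappa v w ->
  (forall t x, 0 <= t <= T -> closure Omega x -> 0 <= w t x) ->
  (forall x, Omega x -> v 0 x = v0 x /\ w 0 x = w0 x) ->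
  forall t, 0 <= t <= T ->
  (Lp_norm Omega (2 * p) (v t) ^+ 2 + Lp_norm Omega p (w t) <=
   C%:E * (Lp_norm Omega (2 * p) v0 ^+ 2 + Lp_norm Omega p w0))%E.
Proof.
case: p => // n k0 _.
exists (2 * (energy_const kappa0 n *+ 2) `^ (n.+1%:R^-1)).
move=> d Omega T eta kappa v0 w0 v w _ smoothO T0 eta0 kappaE sol wpos init t tT.
have oO : open Omega by case: smoothO.
have bO : bounded_set Omega by case: smoothO.
have OO := @subset_closure _ Omega.
have mO := measurable_open_tuple oO.
have zT : (0 : R) <= 0 <= T by apply/andP; split => //; exact: ltW.
have [cv cw] : continuous_up_to_boundary Omega T v /\ continuous_up_to_boundary Omega T w.
  have [vt [Dv [D2v [wt [Dw [D2w]]]]]] := sol.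
  by move=> [Cv Cw _ _ _]; split; [exact: (C12_cont Cv)|exact: (C12_cont Cw)].
have cs (s : R) : 0 <= s <= T -> {within closure Omega, continuous (v s)} /\
    {within closure Omega, continuous (w s)}.
  by move=> sT; split; [exact: (continuous_up_to_boundary_space sT cv)|exact: (continuous_up_to_boundary_space sT cw)].
have ipow q (f : 'rV[R]_d -> R) : {within closure Omega, continuous f} ->
    integrable_over Omega (fun x => `|f x| ^+ q).
  move=> cf; have cO := compact_closure_bounded bO.
  have cq : {within closure Omega, continuous (fun x => `|f x| ^+ q)}.
    move=> x; apply: (@continuous_comp (subspace _) _ _ (fun x => `|f x|) (fun y : R => y ^+ q)).
      by apply: cvg_norm; exact: cf.
    exact: exprn_continuous.
  have [M _ HM] := compact_within_bounded cO cq.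
  apply: (@bounded_integrable_over _ _ _ _ M) => // x Ox.
    exact: (within_continuous_open oO OO cq Ox).
  by apply: HM; exact: OO.
have iE (s : R) : 0 <= s <= T ->
    integrable_over Omega (fun x => energy kappa0 n (v s x) (w s x)).
  move=> sT; have [cvs cws] := cs s sT.
  have cE : {within closure Omega, continuous (fun x => energy kappa0 n (v s x) (w s x))}.
    by move=> x; apply: (@continuous_bipoly R (subspace _)); [exact: cvs|exact: cws].
  have [M _ HM] := compact_within_bounded (compact_closure_bounded bO) cE.
  apply: (@bounded_integrable_over _ _ _ _ M) => // x Ox.
    exact: (within_continuous_open oO OO cE Ox).
  by apply: HM; exact: OO.
pose A s := integral_over Omega (fun x => `|v s x| ^+ (2 * n.+1)).
pose B s := integral_over Omega (fun x => `|w s x| ^+ n.+1).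
have A0 s : 0 <= A s by apply: Rintegral_ge0 => z _; rewrite exprn_ge0.
have B0 s : 0 <= B s by apply: Rintegral_ge0 => z _; rewrite exprn_ge0.
have normE s : 0 <= s <= T ->
    (Lp_norm Omega (2 * n.+1) (v s) ^+ 2 + Lp_norm Omega n.+1 (w s))%E =
    (A s `^ n.+1%:R^-1 + B s `^ n.+1%:R^-1)%:E.
  move=> sT; have [cvs cws] := cs s sT.
  rewrite !Lp_normE//; try exact: ipow.
  rewrite -EFin_expe -EFinD; congr ((_ + _)%:E).
  rewrite -powR_mulrn ?powR_ge0// -powRrM; congr (_ `^ _).
  by rewrite natrM invfM mulrAC mulVf ?mul1r// pnatr_eq0.
have -> : Lp_norm Omega (2 * n.+1) v0 = Lp_norm Omega (2 * n.+1) (v 0).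
  by apply: eq_Lp_norm => x Ox; have [] := init x Ox.
have -> : Lp_norm Omega n.+1 w0 = Lp_norm Omega n.+1 (w 0).
  by apply: eq_Lp_norm => x Ox; have [] := init x Ox.
rewrite !normE// -EFinM lee_fin.
have nvE (s : R) x : `|v s x| ^+ (2 * n.+1) = v s x ^+ (2 * n.+1).
  by rewrite !exprM real_normK// num_real.
have nwE (s : R) x : 0 <= s <= T -> Omega x -> `|w s x| ^+ n.+1 = w s x ^+ n.+1.
  by move=> sT Ox; rewrite ger0_norm// wpos//; exact: OO.
have sumE s : 0 <= s <= T ->
    A s + B s = integral_over Omega (fun x => `|v s x| ^+ (2 * n.+1) + `|w s x| ^+ n.+1).
  by move=> sT; have [cvs cws] := cs s sT; rewrite -integral_overD//; exact: ipow.
have iS s : 0 <= s <= T -> integrable_over Omega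
    (fun x => `|v s x| ^+ (2 * n.+1) + `|w s x| ^+ n.+1).
  move=> sT; have [cvs cws] := cs s sT.
  exact: (integrableD mO (ipow _ _ cvs) (ipow _ _ cws)).
apply: powR_le_sum => //.
  by apply: le_trans (energy_const_ge1 n k0).
apply: (@le_trans _ _ (integral_over Omega (fun x => energy kappa0 n (v t x) (w t x)))).
  rewrite sumE//; apply: le_Rintegral => //; [exact: iS|exact: iE|].
  move=> z Oz; rewrite nvE nwE//; apply: energy_ge => //.
  by apply: wpos => //; exact: OO.
apply: (@le_trans _ _ (integral_over Omega (fun x => energy kappa0 n (v 0 x) (w 0 x)))).
  exact: (energy_nonincreasing n smoothO k0 T0 eta0 kappaE sol wpos tT).
rewrite sumE// /integral_over -RintegralZl//; last exact: iS.
apply: le_Rintegral => //; first exact: iE.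
  by have := integrableZl mO (energy_const kappa0 n) (iS 0 zT).
move=> z Oz; rewrite nvE nwE//; apply: energy_le => //.
by apply: wpos => //; exact: OO.
Qed.
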